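(* For every integer $p \ge 0$ and every real $x > 0$, $$\int_1^x \gamma_p(u)\,du = \frac{(-1)^{p+1}}{p+1}\left[\zeta^{(p+1)}(0,x)-\zeta^{(p+1)}(0)\right].$$
   Context: Let $\zeta(s,u)$ denote the Hurwitz zeta function, i.e. the meromorphic continuation in $s$ of $\sum_{n=0}^\infty (n+u)^{-s}$ ($\operatorname{Re}(s)>1$), $u>0$, and $\zeta(s)=\zeta(s,1)$ the Riemann zeta function. The notation $\zeta^{(j)}(0,x)$ means $\frac{\partial^j}{\partial s^j}\zeta(s,x)$ evaluated at $s=0$, and $\zeta^{(j)}(0)=\zeta^{(j)}(0,1)$. The generalised Stieltjes constants $\gamma_p(u)$ are defined by the Laurent expansion about $s=1$: $$\zeta(s,u)=\frac{1}{s-1}+\sum_{p=0}^{\infty}\frac{(-1)^p}{p!}\gamma_p(u)(s-1)^p .$$ *)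

(* Defs.v *)
From Stdlib Require Import Factorial Reals.
From Coquelicot Require Import Coquelicot.
Open Scope R_scope.

Definition Cexp (z : C) : C :=
  (exp (Re z) * cos (Im z), exp (Re z) * sin (Im z)).

(* a^s for real a > 0 and complex s, with the real logarithm of a. *)
Definition Rpow_C (a : R) (s : C) : C := Cexp (s * ln a)%C.

Definition C_is_pseries (c : nat -> C) (z l : C) : Prop :=
  @is_pseries C_AbsRing C_NormedModule c z l.

Definition analytic_at (f : C -> C) (a : C) : Prop :=
  exists c : nat -> C,
    locally a (fun s : C => C_is_pseries c (s - a)%C (f s)).

(* Near a, f has a Laurent expansion with lowest term c_0 (s - a)^(-m), where
   c_0 <> 0 and m >= 1.  The value f a is irrelevant. *)
Definition pole_at (f : C -> C) (a : C) : Prop :=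
  exists (m : nat) (c : nat -> C),
    (1 <= m)%nat /\ c 0%nat <> RtoC 0 /\
    locally' a (fun s : C => C_is_pseries c (s - a)%C ((s - a) ^ m * f s)%C).

(* Every point is a point of analyticity or a genuine pole, so a removable
   singularity with a wrong value is excluded: f is determined off its poles. *)
Definition meromorphic (f : C -> C) : Prop :=
  forall a : C, analytic_at f a \/ pole_at f a.

(* [zeta s u] is, for each u > 0, the meromorphic continuation to the plane of
   the sum of (n+u)^(-s) over n >= 0.  This fixes [zeta s u] for u > 0, s <> 1;
   the value at the pole s = 1 and the values for u <= 0 are unconstrained. *)
Definition is_hurwitz_zeta (zeta : C -> R -> C) : Prop :=
  forall u : R, 0 < u ->
    meromorphic (fun s : C => zeta s u) /\
    (forall s : C, 1 < Re s ->
      @is_series C_AbsRing C_NormedModule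
        (fun n : nat => Rpow_C (INR n + u) (- s)%C) (zeta s u)).

(* The coefficients are a priori complex, so [gamma] is complex-valued. *)
Definition is_stieltjes (zeta : C -> R -> C) (gamma : nat -> R -> C) : Prop :=
  forall u : R, 0 < u ->
    locally' (RtoC 1) (fun s : C =>
      C_is_pseries
        (fun p : nat => ((-1) ^ p / INR (fact p) * gamma p u)%C)
        (s - 1)%C (zeta s u - 1 / (s - 1))%C).

(* [C_derive] is a total operator; where the complex derivative exists it is
   equal to it ([C_derive_correct]). *)
Fixpoint C_derive_n (f : C -> C) (n : nat) (z : C) : C :=
  match n with
  | O => f z
  | S k => C_derive (C_derive_n f k) z
  end.

(* Main.v *)
Require Import Defs.
From Stdlib Require Import Factorial Reals Lra Lia.
From Coquelicot Require Import Coquelicot.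
Open Scope R_scope.

(** Applying the trapezoidal rule on each interval [[n + u, n + u + 1]] writes
    [zeta(1 + w, u) - 1 / w] as a series whose Taylor coefficients [b_k(u)] at
    [w = 0] are [O((2/3)^k)] locally uniformly in [u]; by uniqueness of Laurent
    coefficients [gamma_k(u) = (-1)^k k! b_k(u)].  The radius [3/2 > 1] makes the
    Laurent expansion at [s = 1] reach [s = 0], so [zeta(., u)], being meromorphic,
    has no pole there.  For real [1 < w < 3/2], integrating term by term both this
    expansion and [sum (n + u)^(-1-w)] over [u] gives
      [zeta(w, x) - zeta(w, 1) = - (x - 1) - w * sum_k w^k int_1^x b_k],
    an identity of analytic functions which propagates along the real axis to a
    neighbourhood of [w = 0], where it is compared coefficient by coefficient. *)

(** * Series in normed modules *)

(** The source of the formula is [d/du zeta(w, u) = - w zeta(1 + w, u)]: integrating in [u] turns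
    data at [s = 1] into data at [s = 0], and the factor [w] moves the index from [p] to [p + 1]. To
    integrate termwise, the Taylor series of [zeta(1 + w, u) - 1 / w] must converge at some real
    [w > 1], where [zeta(w, u)] is still a sum. Comparing that sum with a plain integral leaves
    terms of size [n^(-2 - Re w)], summable only for [Re w > -1], hence a disc of radius 1. The
    trapezoidal rule gains one power and allows [Re w > -2]; 3/2 is a convenient radius between 1
    and 2. Outside [Re s > 1] the hypotheses on [zeta] are local, so identities are carried from
    point to point, and a pole at a point is excluded only once the identity is known on its right.
    Real segments suffice for this: a power series that vanishes at all small positive reals has
    zero coefficients, so the estimates can be made in real variables. *)

Section GenericSeries.
Context {K : AbsRing} {V : NormedModule K}.

Lemma is_series_norm_le (a : nat -> V) (b : nat -> R) (l : V) (L : R) :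
  (forall n, norm (a n) <= b n) -> is_series a l -> is_series b L -> norm l <= L.
Proof.
  intros Hab Ha Hb.
  assert (H1 : is_lim_seq (fun n => norm (sum_n a n)) (norm l)).
  { eapply filterlim_comp. exact Ha. apply filterlim_norm. }
  assert (H2 : is_lim_seq (sum_n b) L) by exact Hb.
  refine (is_lim_seq_le _ _ (Finite (norm l)) (Finite L) _ H1 H2).
  intros n. unfold sum_n. eapply Rle_trans; [apply norm_sum_n_m|].
  apply sum_n_m_le, Hab.
Qed.

Lemma is_series_tail (a : nat -> V) (l : V) (m : nat) :
  is_series a l -> is_series (fun k => a (S m + k)%nat) (minus l (sum_n a m)).
Proof.
  intros H. apply is_series_incr_n; [lia|].
  replace (plus _ _) with l; [exact H|].
  unfold minus. rewrite <- plus_assoc. symmetry.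
  etransitivity; [apply f_equal, (plus_opp_l (sum_n a m))|apply plus_zero_r].
Qed.

Lemma is_series_sum_n (y : nat -> nat -> V) (X : nat -> V) (m : nat) :
  (forall k, is_series (fun N => y N k) (X k)) ->
  is_series (fun N => sum_n (y N) m) (sum_n X m).
Proof.
  intros H. induction m as [|m IH].
  - rewrite sum_O. eapply is_series_ext; [|apply (H 0%nat)].
    intros n; now rewrite sum_O.
  - rewrite sum_Sn. eapply is_series_ext; [|apply (is_series_plus _ _ _ _ IH (H (S m)))].
    intros n; now rewrite sum_Sn.
Qed.

Lemma filterlim_of_norm_le (f : nat -> V) (l : V) (e : nat -> R) :
  (forall n, norm (minus (f n) l) <= e n) -> is_lim_seq e 0 ->
  filterlim f eventually (locally l).
Proof.
  intros H He. apply filterlim_locally. intros eps.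
  apply is_lim_seq_spec in He. destruct (He eps) as [N HN].
  exists N. intros n Hn. apply norm_compat1.
  eapply Rle_lt_trans; [apply H|].
  specialize (HN n Hn). rewrite Rminus_0_r in HN.
  eapply Rle_lt_trans; [apply Rle_abs|exact HN].
Qed.

End GenericSeries.

(** A majorant of product form is enough: the tail of row [N] beyond column [m] is at most [A N]
    times the tail of [B], so the column sums up to [m] differ from [S] by at most [SA] times that
    tail. *)
Lemma series_fubini {K : AbsRing} {V : CompleteNormedModule K}
  (y : nat -> nat -> CompleteNormedModule.NormedModule K V)
  (A B : nat -> R) (s X : nat -> CompleteNormedModule.NormedModule K V) :
  (forall N k, norm (y N k) <= A N * B k) ->
  ex_series A -> ex_series B ->
  (forall N, is_series (y N) (s N)) ->
  (forall k, is_series (fun N => y N k) (X k)) ->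
  exists S, is_series s S /\ is_series X S.
Proof.
  intros Hy [SA HA] [SB HB] Hs HX.
  assert (HsN : forall N, norm (s N) <= A N * SB).
  { intros N. refine (is_series_norm_le _ _ _ _ (Hy N) (Hs N) _).
    exact (is_series_scal (A N) B SB HB). }
  destruct (ex_series_le s (fun N => A N * SB) HsN) as [S HS].
  { exists (scal SB SA). eapply is_series_ext; [|apply (is_series_scal SB A SA HA)].
    intros n. apply Rmult_comm. }
  exists S; split; [exact HS|].
  apply filterlim_of_norm_le with (e := fun m => SA * (SB - sum_n B m)).
  2:{ replace (Finite 0) with (Rbar_mult SA (SB - SB)) by (simpl; f_equal; ring).
      apply is_lim_seq_scal_l, is_lim_seq_minus'; [apply is_lim_seq_const|exact HB]. }
  intros m.
  rewrite <- norm_opp, opp_minus.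
  refine (is_series_norm_le (fun N => minus (s N) (sum_n (y N) m))
           (fun N => A N * (SB - sum_n B m)) _ _ _ _ _).
  - intros N.
    refine (is_series_norm_le _ _ _ _ _ (is_series_tail _ _ m (Hs N)) _).
    + intros k. apply Hy.
    + exact (is_series_scal (A N) _ _ (is_series_tail B SB m HB)).
  - apply (is_series_plus s (fun N => opp (sum_n (y N) m)) S (opp (sum_n X m)) HS).
    apply (is_series_opp _ _ (is_series_sum_n y X m HX)).
  - replace (SA * (SB - sum_n B m)) with (scal (SB - sum_n B m) SA)
      by (apply Rmult_comm).
    eapply is_series_ext; [|apply (is_series_scal (SB - sum_n B m) A SA HA)].
    intros n; apply Rmult_comm.
Qed.


Lemma is_series_Rscal (c : R) (a : nat -> R) (l : R) :
  is_series a l -> is_series (fun n => c * a n) (c * l).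
Proof. exact (is_series_scal (K := R_AbsRing) (V := R_NormedModule) c a l). Qed.

Lemma is_series_Rext (a b : nat -> R) (l l' : R) :
  (forall n, a n = b n) -> l = l' -> is_series a l -> is_series b l'.
Proof. intros H -> Ha. eapply is_series_ext; eassumption. Qed.

Lemma is_series_Rtail (a : nat -> R) (l : R) :
  is_series a l -> is_series (fun n => a (S n)) (l - a 0%nat).
Proof.
  intros H. apply is_series_incr_1.
  apply (is_series_Rext a a l ((l - a 0%nat) + a 0%nat)); [reflexivity|ring|exact H].
Qed.

(** * Complex power series *)

Local Notation Cser := (@is_series C_AbsRing C_NormedModule).

Lemma C_is_pseries_iff (c : nat -> C) (z l : C) :
  C_is_pseries c z l <-> Cser (fun k => (c k * z ^ k)%C) l.
Proof.
  assert (E : forall k, @scal C_AbsRing C_NormedModule (pow_n (z : C_AbsRing) k) (c k) = (c k * z ^ k)%C).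
  { intros k. change (pow_n (z : C_AbsRing) k * c k = c k * z ^ k)%C. rewrite Cmult_comm. reflexivity. }
  split; intros H; eapply is_series_ext; try exact H; intros n.
  - apply E.
  - symmetry; apply E.
Qed.

Lemma Cser_unique (a : nat -> C) (l l' : C) : Cser a l -> Cser a l' -> l = l'.
Proof. apply filterlim_locally_unique. Qed.

Lemma Cser_ext (a b : nat -> C) (l l' : C) :
  (forall n, a n = b n) -> l = l' -> Cser a l -> Cser b l'.
Proof. intros H -> Ha. eapply is_series_ext; eassumption. Qed.

Lemma Cser_plus (a b : nat -> C) (l l' : C) :
  Cser a l -> Cser b l' -> Cser (fun n => (a n + b n)%C) (l + l')%C.
Proof. exact (is_series_plus a b l l'). Qed.

Lemma Cser_minus (a b : nat -> C) (l l' : C) :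
  Cser a l -> Cser b l' -> Cser (fun n => (a n - b n)%C) (l - l')%C.
Proof. exact (is_series_minus a b l l'). Qed.

Lemma Cser_scal (c : C) (a : nat -> C) (l : C) :
  Cser a l -> Cser (fun n => (c * a n)%C) (c * l)%C.
Proof. exact (is_series_scal (K := C_AbsRing) (V := C_NormedModule) c a l). Qed.

Lemma Cser_tail (a : nat -> C) (l : C) :
  Cser a l -> Cser (fun n => a (S n)) (l - a 0%nat)%C.
Proof.
  intros H. apply is_series_incr_1.
  change (Cser a ((l - a 0%nat) + a 0%nat)%C).
  now replace ((l - a 0%nat) + a 0%nat)%C with l by ring.
Qed.

Lemma Cser_cons (a : nat -> C) (l : C) :
  Cser (fun n => a (S n)) l -> Cser a (l + a 0%nat)%C.
Proof.
  intros H. apply is_series_decr_1.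
  change (Cser (fun n => a (S n)) ((l + a 0%nat) - a 0%nat)%C).
  now replace ((l + a 0%nat) - a 0%nat)%C with l by ring.
Qed.

Lemma Cser_zero : Cser (fun _ => RtoC 0) (RtoC 0).
Proof.
  apply filterlim_ext with (fun _ : nat => RtoC 0).
  - intros n. induction n as [|n IH].
    + now rewrite sum_O.
    + rewrite sum_Sn, <- IH. symmetry. apply Cplus_0_l.
  - apply filterlim_const.
Qed.

Lemma Cser_norm_le (a : nat -> C) (b : nat -> R) (l : C) (L : R) :
  (forall n, Cmod (a n) <= b n) -> Cser a l -> is_series b L -> Cmod l <= L.
Proof. exact (is_series_norm_le (V := C_CompleteNormedModule) a b l L). Qed.

Lemma Cser_bounded (a : nat -> C) (l : C) :
  Cser a l -> exists M, forall n, Cmod (a n) <= M.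
Proof.
  intros H.
  destruct (filterlim_bounded (V := C_NormedModule) (sum_n a) (ex_intro _ l H)) as [B HB'].
  exists (2 * B). intros n.
  change (forall n, Cmod (sum_n a n) <= B) in HB'.
  destruct n as [|n].
  - specialize (HB' 0%nat). rewrite sum_O in HB'.
    generalize (Cmod_ge_0 (a 0%nat)). lra.
  - replace (a (S n)) with (sum_n a (S n) + - sum_n a n)%C.
    2:{ rewrite sum_Sn. unfold plus; simpl. ring. }
    eapply Rle_trans; [apply Cmod_triangle|]. rewrite Cmod_opp.
    generalize (HB' n) (HB' (S n)). lra.
Qed.

(** Bounds [|c_k| r^k <= M] stand in for the radius of convergence throughout. On the half disc they
    leave a geometric series of ratio 1/2, hence the factor 2. *)
Lemma pseries_le (c : nat -> C) (r M : R) (h l : C) :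
  0 < r -> (forall k, Cmod (c k) * r ^ k <= M) -> Cmod h <= r / 2 ->
  Cser (fun k => (c k * h ^ k)%C) l -> Cmod l <= 2 * M.
Proof.
  intros Hr HM Hh Hl.
  assert (HM0 : 0 <= M).
  { eapply Rle_trans; [|apply (HM 0%nat)]. simpl. rewrite Rmult_1_r. apply Cmod_ge_0. }
  refine (Cser_norm_le _ (fun k => M * (/ 2) ^ k) _ _ _ Hl _).
  - intros k. rewrite Cmod_mult, Cmod_pow.
    apply Rle_trans with (Cmod (c k) * (r * / 2) ^ k).
    + apply Rmult_le_compat_l; [apply Cmod_ge_0|].
      apply pow_incr; split; [apply Cmod_ge_0|exact Hh].
    + rewrite Rpow_mult_distr, <- Rmult_assoc.
      apply Rmult_le_compat_r; [|apply HM]. apply pow_le; lra.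
  - replace (2 * M) with (M * / (1 - / 2)) by field.
    apply is_series_Rscal. apply is_series_geom. rewrite Rabs_pos_eq; lra.
Qed.

Lemma pseries_shift (c : nat -> C) (h l : C) :
  h <> (RtoC 0) -> Cser (fun k => (c k * h ^ k)%C) l ->
  Cser (fun k => (c (S k) * h ^ k)%C) ((l - c 0%nat) / h)%C.
Proof.
  intros Hh Hl. apply Cser_tail in Hl.
  apply (Cser_scal (/ h)%C) in Hl.
  eapply Cser_ext; [| |exact Hl].
  - intros n. cbv beta. rewrite Cpow_S. field. exact Hh.
  - simpl. field. exact Hh.
Qed.

Lemma bound_shift (c : nat -> C) (r M : R) :
  0 < r -> (forall k, Cmod (c k) * r ^ k <= M) ->
  forall k, Cmod (c (S k)) * r ^ k <= M / r.
Proof.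
  intros Hr HM k. apply Rmult_le_reg_r with r; [exact Hr|].
  replace (M / r * r) with M by (field; lra).
  specialize (HM (S k)). simpl in HM. lra.
Qed.

(** This is [pseries_le] for the divided series [(l - c_0) / h], whose shifted coefficients have the
    bound [M / r]. *)
Lemma pseries_first_order (c : nat -> C) (r M : R) (h l : C) :
  0 < r -> (forall k, Cmod (c k) * r ^ k <= M) -> Cmod h <= r / 2 ->
  Cser (fun k => (c k * h ^ k)%C) l -> Cmod (l - c 0%nat)%C <= 2 * (M / r) * Cmod h.
Proof.
  intros Hr HM Hh Hl.
  destruct (Ceq_dec h 0) as [->|Hh0].
  - replace l with (c 0%nat).
    + replace (c 0%nat - c 0%nat)%C with (RtoC 0) by ring. rewrite Cmod_0. lra.
    + apply (Cser_unique (fun k => (c k * 0 ^ k)%C)); [|exact Hl].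
      assert (H0 : Cser (fun k => (c (S k) * 0 ^ (S k))%C) (RtoC 0)).
      { eapply Cser_ext; [| |exact Cser_zero]; [|reflexivity].
        intros n. cbv beta. rewrite Cpow_S. ring. }
      eapply Cser_ext; [intros n; reflexivity| |
        apply (Cser_cons (fun k => (c k * 0 ^ k)%C) _ H0)].
      simpl. ring.
  - replace (l - c 0%nat)%C with (((l - c 0%nat) / h) * h)%C by (field; exact Hh0).
    rewrite Cmod_mult. apply Rmult_le_compat_r; [apply Cmod_ge_0|].
    exact (pseries_le _ r _ h _ Hr (bound_shift c r M Hr HM) Hh (pseries_shift c h l Hh0 Hl)).
Qed.

Lemma pseries_bound_of_conv (c : nat -> C) (r : R) (l : C) :
  0 < r -> Cser (fun k => (c k * RtoC r ^ k)%C) l ->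
  exists M, forall k, Cmod (c k) * r ^ k <= M.
Proof.
  intros Hr H. destruct (Cser_bounded _ _ H) as [M HM]. exists M. intros k.
  specialize (HM k). rewrite Cmod_mult, Cmod_pow, Cmod_R, (Rabs_pos_eq r) in HM; lra.
Qed.

Lemma RtoC_nz (t : R) : t <> 0 -> RtoC t <> (RtoC 0).
Proof. intros H E. apply H. now apply RtoC_inj. Qed.

Lemma Rle_0_of_small (x K d : R) :
  0 < d -> (forall t, 0 < t < d -> x <= K * t) -> x <= 0.
Proof.
  intros Hd H. apply Rnot_lt_le. intros Hx.
  set (L := Rabs K + 1). assert (HL : 0 < L) by (unfold L; generalize (Rabs_pos K); lra).
  set (t := Rmin (d / 2) (x / (2 * L))).
  assert (Ht : 0 < t < d).
  { unfold t; split.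
    - apply Rmin_glb_lt; [lra|]. apply Rdiv_lt_0_compat; lra.
    - eapply Rle_lt_trans; [apply Rmin_l|lra]. }
  specialize (H t Ht).
  assert (K * t <= L * (x / (2 * L))).
  { apply Rle_trans with (L * t).
    - apply Rmult_le_compat_r; [lra|]. unfold L. generalize (Rle_abs K); lra.
    - apply Rmult_le_compat_l; [lra|]. apply Rmin_r. }
  replace (L * (x / (2 * L))) with (x / 2) in H0 by (field; lra). lra.
Qed.

Lemma pseries_zero_head (c : nat -> C) (d : R) :
  0 < d -> (forall t, 0 < t < d -> Cser (fun k => (c k * RtoC t ^ k)%C) (RtoC 0)) ->
  c 0%nat = (RtoC 0).
Proof.
  intros Hd H.
  destruct (pseries_bound_of_conv c (d / 2) (RtoC 0)) as [M HM]; [lra|apply H; lra|].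
  apply Cmod_eq_0, Rle_antisym; [|apply Cmod_ge_0].
  apply Rle_0_of_small with (2 * (M / (d / 2))) (d / 4); [lra|]. intros t Ht.
  assert (H1 := pseries_first_order c (d / 2) M (RtoC t) (RtoC 0)).
  rewrite Cmod_R, Rabs_pos_eq in H1 by lra.
  replace (0 - c 0%nat)%C with (- c 0%nat)%C in H1 by ring.
  rewrite Cmod_opp in H1. apply H1; try lra; [exact HM|apply H; lra].
Qed.

(** Once the head vanishes, division by [t] gives the same hypothesis for the shifted sequence. Only
    positive real [t] enter, so identities from real analysis determine complex coefficients. *)
Lemma pseries_zero (k : nat) : forall (c : nat -> C) (d : R),
  0 < d -> (forall t, 0 < t < d -> Cser (fun k => (c k * RtoC t ^ k)%C) (RtoC 0)) ->
  c k = (RtoC 0).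
Proof.
  induction k as [|k IH]; intros c d Hd H.
  - exact (pseries_zero_head c d Hd H).
  - apply (IH (fun j => c (S j)) d Hd). intros t Ht.
    eapply Cser_ext; [intros n; reflexivity| |
      apply (pseries_shift c (RtoC t) (RtoC 0)); [apply RtoC_nz; lra|apply H, Ht]].
    rewrite (pseries_zero_head c d Hd H). field. apply RtoC_nz; lra.
Qed.

(* Coefficient of [h ^ j] in [(z + h) ^ N]. *)
Fixpoint shift_coef (z : C) (N j : nat) : C :=
  match N, j with
  | O, O => (RtoC 1)
  | O, S _ => (RtoC 0)
  | S N', O => (z * shift_coef z N' O)%C
  | S N', S j' => (z * shift_coef z N' (S j') + shift_coef z N' j')%C
  end.

Lemma shift_coef_series (z h : C) (N : nat) :
  Cser (fun j => (shift_coef z N j * h ^ j)%C) ((z + h) ^ N)%C.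
Proof.
  induction N as [|N IH].
  - eapply Cser_ext; [intros n; reflexivity| |
      apply (Cser_cons (fun j => (shift_coef z 0 j * h ^ j)%C) (RtoC 0))].
    + simpl. ring.
    + eapply Cser_ext; [| |exact Cser_zero]; [|reflexivity].
      intros n. simpl. ring.
  - assert (H := Cser_plus _ _ _ _ (Cser_tail _ _ (Cser_scal z _ _ IH)) (Cser_scal h _ _ IH)).
    eapply Cser_ext; [intros n; reflexivity| |
      apply (Cser_cons (fun j => (shift_coef z (S N) j * h ^ j)%C))].
    2:{ eapply Cser_ext; [|reflexivity|exact H]. intros n. cbv beta. cbn [shift_coef]. rewrite Cpow_S. ring. }
    cbn [shift_coef]. rewrite Cpow_S. simpl. ring.
Qed.

(** The left side is one of the nonnegative terms in the binomial expansion of the right side. *)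
Lemma shift_coef_le (z : C) (r : R) (N : nat) : 0 <= r ->
  forall j, Cmod (shift_coef z N j) * r ^ j <= (Cmod z + r) ^ N.
Proof.
  intros Hr. assert (Hz := Cmod_ge_0 z).
  induction N as [|N IH]; intros j.
  - destruct j as [|j]; cbn [shift_coef].
    + rewrite Cmod_1. simpl. lra.
    + rewrite Cmod_0. simpl. lra.
  - assert (HP : 0 <= (Cmod z + r) ^ N) by (apply pow_le; lra).
    destruct j as [|j]; cbn [shift_coef].
    + rewrite Cmod_mult. specialize (IH 0%nat). simpl in *.
      rewrite Rmult_1_r in *.
      apply Rle_trans with (Cmod z * (Cmod z + r) ^ N).
      * now apply Rmult_le_compat_l.
      * apply Rmult_le_compat_r; lra.
    + apply Rle_trans with
        ((Cmod z * Cmod (shift_coef z N (S j)) + Cmod (shift_coef z N j)) * r ^ S j).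
      * apply Rmult_le_compat_r; [apply pow_le; lra|].
        eapply Rle_trans; [apply Cmod_triangle|]. rewrite Cmod_mult. lra.
      * apply Rle_trans with (Cmod z * (Cmod (shift_coef z N (S j)) * r ^ S j)
                              + r * (Cmod (shift_coef z N j) * r ^ j)).
        { right. simpl. ring. }
        generalize (Rmult_le_compat_l _ _ _ Hz (IH (S j)))
                   (Rmult_le_compat_l _ _ _ Hr (IH j)). simpl. lra.
Qed.

(** The coefficient of [h] is the derivative of [z^N]; termwise derivatives of power series are read
    off from it. *)
Lemma shift_coef_1 (z : C) (N : nat) :
  shift_coef z 0 1 = (RtoC 0) /\ shift_coef z (S N) 1 = (RtoC (INR (S N)) * z ^ N)%C.
Proof.
  split; [reflexivity|].
  assert (H0 : forall n, shift_coef z n 0 = (z ^ n)%C).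
  { induction n as [|n IH]; [reflexivity|]. cbn [shift_coef]. now rewrite IH, Cpow_S. }
  induction N as [|N IH].
  - cbn [shift_coef]. simpl. ring.
  - change (shift_coef z (S (S N)) 1) with (z * shift_coef z (S N) 1 + shift_coef z (S N) 0)%C.
    rewrite IH, H0, (S_INR (S N)), RtoC_plus. rewrite (Cpow_S z N). ring.
Qed.

(** * Power series expansions of complex functions *)

(** Unlike in [analytic_at], the radius is explicit: recentring and continuation must know how far
    each expansion reaches. *)
Definition expands (f : C -> C) (a : C) (c : nat -> C) (rho : R) : Prop :=
  forall s : C, Cmod (s - a) < rho -> Cser (fun k => (c k * (s - a) ^ k)%C) (f s).

Definition Csum (a : nat -> C) : C :=
  iota (T := C_CompleteNormedModule) (fun l => Cser a l).

Lemma Csum_correct (a : nat -> C) : (exists l, Cser a l) -> Cser a (Csum a).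
Proof.
  intros [l Hl]. unfold Csum.
  apply (iota_correct (V := C_CompleteNormedModule) (fun l => Cser a l)).
  exists l. split; [exact Hl|]. intros l' Hl'. exact (Cser_unique a l l' Hl Hl').
Qed.

Lemma Cser_ex_le (a : nat -> C) (b : nat -> R) :
  (forall n, Cmod (a n) <= b n) -> ex_series b -> exists l, Cser a l.
Proof. exact (ex_series_le (V := C_CompleteNormedModule) a b). Qed.

Lemma pow_ratio_le (x r M q : R) (k : nat) :
  0 < r -> 0 <= q -> x * r ^ k <= M -> x * q ^ k <= M * (q / r) ^ k.
Proof.
  intros Hr Hq H.
  replace q with (r * (q / r)) at 1 by (field; lra).
  rewrite Rpow_mult_distr, <- Rmult_assoc.
  apply Rmult_le_compat_r; [|exact H]. apply pow_le, Rdiv_le_0_compat; lra.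
Qed.

Lemma ex_series_ratio (M q r : R) :
  0 <= q < r -> ex_series (fun k => M * (q / r) ^ k).
Proof.
  intros H. exists (M * / (1 - q / r)). apply is_series_Rscal, is_series_geom.
  rewrite Rabs_pos_eq; [|apply Rdiv_le_0_compat; lra].
  apply Rmult_lt_reg_r with r; [lra|]. replace (q / r * r) with q by (field; lra). lra.
Qed.

Lemma expands_of_bound (c : nat -> C) (a : C) (r M : R) :
  0 < r -> (forall k, Cmod (c k) * r ^ k <= M) ->
  expands (fun s => Csum (fun k => (c k * (s - a) ^ k)%C)) a c r.
Proof.
  intros Hr HM s Hs. apply Csum_correct.
  apply Cser_ex_le with (fun k => M * (Cmod (s - a) / r) ^ k).
  - intros n. rewrite Cmod_mult, Cmod_pow.
    apply pow_ratio_le; [exact Hr|apply Cmod_ge_0|apply HM].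
  - apply ex_series_ratio. split; [apply Cmod_ge_0|exact Hs].
Qed.

Lemma Cminus_diag (a : C) : (a - a)%C = RtoC 0.
Proof. ring. Qed.

Lemma expands_le (f : C -> C) (a : C) (c : nat -> C) (r rho : R) :
  r <= rho -> expands f a c rho -> expands f a c r.
Proof. intros Hr H s Hs. apply H. lra. Qed.

Lemma expands_bound (f : C -> C) (a : C) (c : nat -> C) (r rho : R) :
  0 < r < rho -> expands f a c rho -> exists M, forall k, Cmod (c k) * r ^ k <= M.
Proof.
  intros Hr H.
  assert (E : (a + RtoC r - a)%C = RtoC r) by ring.
  assert (H1 := H (a + RtoC r)%C). rewrite E in H1.
  apply (pseries_bound_of_conv c r (f (a + RtoC r)%C)); [lra|]. apply H1.
  rewrite Cmod_R, Rabs_pos_eq; lra.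
Qed.

Lemma expands_center (f : C -> C) (a : C) (c : nat -> C) (rho : R) :
  0 < rho -> expands f a c rho -> f a = c 0%nat.
Proof.
  intros Hr H.
  destruct (expands_bound f a c (rho / 2) rho) as [M HM]; [lra|exact H|].
  assert (Ha : Cmod (a - a) < rho) by (rewrite Cminus_diag, Cmod_0; lra).
  assert (H1 := pseries_first_order c (rho / 2) M (a - a)%C (f a)).
  specialize (H a Ha). rewrite Cminus_diag, Cmod_0 in *.
  assert (H2 : Cmod (f a - c 0%nat) = 0).
  { apply Rle_antisym; [|apply Cmod_ge_0].
    eapply Rle_trans; [apply H1; [lra|exact HM|lra|exact H]|lra]. }
  apply Cmod_eq_0 in H2. now apply Ceq_minus.
Qed.

Lemma expands_first_order (f : C -> C) (a : C) (c : nat -> C) (rho : R) :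
  0 < rho -> expands f a c rho ->
  exists K r, 0 < r /\ forall s, Cmod (s - a) < r ->
    Cmod (f s - f a) <= K * Cmod (s - a).
Proof.
  intros Hr H. rewrite (expands_center f a c rho Hr H).
  destruct (expands_bound f a c (rho / 2) rho) as [M HM]; [lra|exact H|].
  exists (2 * (M / (rho / 2))), (rho / 4). split; [lra|]. intros s Hs.
  apply pseries_first_order; [lra|exact HM|lra|]. apply H. lra.
Qed.

(** One division by [s - a] reduces this to the first-order estimate; it exhibits [c 1] as the
    derivative at the centre. *)
Lemma expands_second_order (f : C -> C) (a : C) (c : nat -> C) (rho : R) :
  0 < rho -> expands f a c rho ->
  exists K r, 0 < r /\ forall s, Cmod (s - a) < r ->
    Cmod (f s - f a - (s - a) * c 1%nat) <= K * Cmod (s - a) * Cmod (s - a).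
Proof.
  intros Hr H.
  destruct (expands_bound f a c (rho / 2) rho) as [M HM]; [lra|exact H|].
  exists (2 * (M / (rho / 2) / (rho / 2))), (rho / 4). split; [lra|]. intros s Hs.
  rewrite (expands_center f a c rho Hr H).
  destruct (Ceq_dec (s - a) (RtoC 0)) as [E|E].
  - assert (Es : s = a) by now apply Ceq_minus.
    rewrite E, Es, (expands_center f a c rho Hr H), Cmod_0.
    replace (c 0%nat - c 0%nat - 0 * c 1%nat)%C with (RtoC 0) by ring.
    rewrite Cmod_0. lra.
  - replace (f s - c 0%nat - (s - a) * c 1%nat)%C
      with (((f s - c 0%nat) / (s - a) - c 1%nat) * (s - a))%C by (field; exact E).
    rewrite Cmod_mult. apply Rmult_le_compat_r; [apply Cmod_ge_0|].
    apply (pseries_first_order (fun k => c (S k))); [lra| |lra|].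
    + apply bound_shift; [lra|exact HM].
    + apply pseries_shift; [exact E|]. apply H. lra.
Qed.

(** With [z = b - a] and [h = s - b], expand [(z + h)^N] and exchange the sums, which is legitimate
    while [|z| + |h| < rho]. The series for [d j] stays in the conclusion because [d 1] will serve
    as the derivative at [b]. *)
Lemma expands_recenter (f : C -> C) (a b : C) (c : nat -> C) (rho : R) :
  expands f a c rho -> Cmod (b - a) < rho ->
  exists d, (forall j, Cser (fun N => (c N * shift_coef (b - a) N j)%C) (d j)) /\
    expands f b d (rho - Cmod (b - a)).
Proof.
  intros H Hb. set (z := (b - a)%C) in *.
  assert (Hz := Cmod_ge_0 z).
  (* Geometric majorant making the double series absolutely convergent. *)
  assert (Hmaj : forall r, 0 < r < rho - Cmod z -> exists M q,
    ex_series (fun N => M * q ^ N) /\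
    forall N j, Cmod (c N * shift_coef z N j) * r ^ j <= M * q ^ N).
  (* [R1] is the midpoint of [|z| + r] and [rho]: the coefficients are at most [M / R1^N], and
     [(|z| + r) / R1 < 1]. *)
  { intros r Hr. set (R1 := (Cmod z + r + rho) / 2).
    destruct (expands_bound f a c R1 rho) as [M HM]; [unfold R1; lra|exact H|].
    exists M, ((Cmod z + r) / R1). split.
    - apply ex_series_ratio. unfold R1; lra.
    - intros N j. rewrite Cmod_mult, Rmult_assoc.
      apply Rle_trans with (Cmod (c N) * (Cmod z + r) ^ N).
      + apply Rmult_le_compat_l; [apply Cmod_ge_0|]. apply shift_coef_le; lra.
      + apply pow_ratio_le; [unfold R1; lra|lra|apply HM]. }
  set (d := fun j => Csum (fun N => (c N * shift_coef z N j)%C)).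
  assert (Hd : forall j, Cser (fun N => (c N * shift_coef z N j)%C) (d j)).
  { intros j. apply Csum_correct.
    set (r := (rho - Cmod z) / 2). assert (Hr : 0 < r < rho - Cmod z) by (unfold r; lra).
    destruct (Hmaj r Hr) as (M & q & [S HS] & HM).
    apply Cser_ex_le with (fun N => / r ^ j * (M * q ^ N)).
    - intros N. assert (Hp : 0 < r ^ j) by (apply pow_lt; lra).
      apply Rmult_le_reg_r with (r ^ j); [exact Hp|].
      replace (/ r ^ j * (M * q ^ N) * r ^ j) with (M * q ^ N) by (field; lra). apply HM.
    - exists (/ r ^ j * S). now apply is_series_Rscal. }
  exists d. split; [exact Hd|]. intros s Hs. set (h := (s - b)%C) in *.
  assert (Hh := Cmod_ge_0 h).
  (* A radius strictly between [|h|] and [rho - |z|] leaves the geometric factor [(|h| / r)^j] for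
     the inner index. *)
  set (r := (Cmod h + (rho - Cmod z)) / 2).
  assert (Hr : 0 < r < rho - Cmod z) by (unfold r; lra).
  destruct (Hmaj r Hr) as (M & q & HS & HM).
  destruct (series_fubini (V := C_CompleteNormedModule)
    (fun N j => (c N * shift_coef z N j * h ^ j)%C)
    (fun N => M * q ^ N) (fun j => (Cmod h / r) ^ j)
    (fun N => (c N * (z + h) ^ N)%C) (fun j => (d j * h ^ j)%C)) as (S & HS1 & HS2).
  - intros N j. change (Cmod (c N * shift_coef z N j * h ^ j) <= M * q ^ N * (Cmod h / r) ^ j).
    rewrite Cmod_mult, Cmod_pow. apply pow_ratio_le; [lra|exact Hh|apply HM].
  - exact HS.
  - destruct (ex_series_ratio 1 (Cmod h) r) as [l Hl]; [unfold r; lra|].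
    exists l. eapply is_series_ext; [|exact Hl]. intros n. apply Rmult_1_l.
  - intros N. eapply Cser_ext; [| |apply (Cser_scal (c N) _ _ (shift_coef_series z h N))].
    + intros n. cbv beta. ring.
    + reflexivity.
  - intros j. eapply Cser_ext; [| |apply (Cser_scal (h ^ j)%C _ _ (Hd j))].
    + intros n. cbv beta. ring.
    + cbv beta. ring.
  - replace (f s) with S; [exact HS2|].
    apply (Cser_unique (fun N => (c N * (z + h) ^ N)%C)); [exact HS1|].
    replace (z + h)%C with (s - a)%C by (unfold z, h; ring).
    apply H. replace (s - a)%C with (z + h)%C by (unfold z, h; ring).
    eapply Rle_lt_trans; [apply Cmod_triangle|]. lra.
Qed.

Lemma Cmod_of_locally (a : C) (P : C -> Prop) :
  locally a P -> exists r, 0 < r /\ forall s, Cmod (s - a) < r -> P s.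
Proof.
  intros [eps H]. exists eps. split; [apply cond_pos|].
  intros s Hs. apply H. apply (norm_compat1 (V := C_NormedModule)). exact Hs.
Qed.

Lemma is_derive_of_second_order (f : C -> C) (a l : C) (K r : R) :
  0 < r -> (forall s, Cmod (s - a) < r ->
    Cmod (f s - f a - (s - a) * l) <= K * Cmod (s - a) * Cmod (s - a)) ->
  @is_derive C_AbsRing C_NormedModule f a l.
Proof.
  intros Hr H. split; [apply is_linear_scal_l|].
  intros x Hx eps.
  apply (is_filter_lim_locally_unique (V := AbsRing_NormedModule C_AbsRing)) in Hx.
  subst x.
  set (r' := Rmin r (eps / (Rabs K + 1))).
  assert (HK := Rabs_pos K).
  assert (Hr' : 0 < r').
  { apply Rmin_glb_lt; [exact Hr|]. apply Rdiv_lt_0_compat; [apply cond_pos|lra]. }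
  exists (mkposreal r' Hr'). intros s Hs. change (Cmod (s - a) < r') in Hs.
  change (Cmod (f s - f a - (s - a) * l) <= eps * Cmod (s - a)).
  eapply Rle_trans; [apply H; eapply Rlt_le_trans; [exact Hs|apply Rmin_l]|].
  apply Rmult_le_compat_r; [apply Cmod_ge_0|].
  apply Rle_trans with ((Rabs K + 1) * (eps / (Rabs K + 1))).
  - apply Rle_trans with ((Rabs K + 1) * Cmod (s - a)).
    + apply Rmult_le_compat_r; [apply Cmod_ge_0|]. generalize (Rle_abs K); lra.
    + apply Rmult_le_compat_l; [lra|]. left. eapply Rlt_le_trans; [exact Hs|apply Rmin_r].
  - right. field. lra.
Qed.

(** No sum is differentiated: recentring at [s] makes the derivative equal to [d 1], which is
    already the series of [N c_N (s - a)^(N-1)]; its vanishing term [N = 0] is dropped. The radius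
    is unchanged, so the lemma can be iterated. *)
Lemma expands_C_derive (f : C -> C) (a : C) (c : nat -> C) (rho : R) :
  expands f a c rho ->
  expands (C_derive f) a (fun k => (RtoC (INR (S k)) * c (S k))%C) rho.
Proof.
  intros H s Hs.
  destruct (expands_recenter f a s c rho H Hs) as (d & Hd & Hf).
  destruct (expands_second_order f s d (rho - Cmod (s - a))) as (K & r & Hr & HK);
    [lra|exact Hf|].
  rewrite (is_C_derive_unique f s (d 1%nat)).
  2:{ exact (is_derive_of_second_order f s (d 1%nat) K r Hr HK). }
  assert (H1 := Cser_tail _ _ (Hd 1%nat)).
  eapply Cser_ext; [| |exact H1].
  - intros n. cbv beta. rewrite (proj2 (shift_coef_1 (s - a) n)). ring.
  - cbv beta. rewrite (proj1 (shift_coef_1 (s - a) 0)). ring.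
Qed.

Lemma expands_C_derive_n (f : C -> C) (a : C) (c : nat -> C) (rho : R) (n : nat) :
  expands f a c rho ->
  expands (C_derive_n f n) a
    (fun k => (RtoC (INR (fact (k + n)) / INR (fact k)) * c (k + n)%nat)%C) rho.
Proof.
  intros H. induction n as [|n IH].
  - intros s Hs. eapply Cser_ext; [|reflexivity|apply (H s Hs)].
    intros k. cbv beta. rewrite Nat.add_0_r.
    replace (INR (fact k) / INR (fact k)) with 1 by (field; apply INR_fact_neq_0). ring.
  - apply expands_C_derive in IH. intros s Hs.
    eapply Cser_ext; [|reflexivity|apply (IH s Hs)].
    intros k. cbv beta. rewrite Cmult_assoc, <- RtoC_mult.
    replace (S k + n)%nat with (k + S n)%nat by lia. f_equal. f_equal. f_equal.
    rewrite fact_simpl, mult_INR. field. split; [apply INR_fact_neq_0|].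
    apply not_0_INR. lia.
Qed.

Lemma C_derive_n_center (f : C -> C) (a : C) (c : nat -> C) (rho : R) (n : nat) :
  0 < rho -> expands f a c rho ->
  C_derive_n f n a = (RtoC (INR (fact n)) * c n)%C.
Proof.
  intros Hr H.
  rewrite (expands_center _ _ _ _ Hr (expands_C_derive_n f a c rho n H)).
  simpl. f_equal. f_equal. field.
Qed.

(** * The identity theorem along a real segment *)

Lemma expands_zero (f : C -> C) (a : R) (c : nat -> C) (rho d : R) :
  0 < rho -> 0 < d -> expands f a c rho ->
  (forall t : R, a < t < a + d -> f t = RtoC 0) -> forall k, c k = RtoC 0.
Proof.
  intros Hr Hd H Hz k.
  apply (pseries_zero k c (Rmin d rho)); [apply Rmin_glb_lt; lra|].
  intros t Ht.
  assert (Ht1 : t < d) by (eapply Rlt_le_trans; [apply Ht|apply Rmin_l]).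
  assert (Ht2 : t < rho) by (eapply Rlt_le_trans; [apply Ht|apply Rmin_r]).
  rewrite <- (Hz (a + t)) by lra.
  assert (E : (RtoC (a + t) - RtoC a)%C = RtoC t) by (rewrite RtoC_plus; ring).
  rewrite <- E. apply H. rewrite E, Cmod_R, Rabs_pos_eq; lra.
Qed.

Lemma expands_zero_near (f : C -> C) (a : R) (c : nat -> C) (rho d : R) :
  0 < rho -> 0 < d -> expands f a c rho ->
  (forall t : R, a < t < a + d -> f t = RtoC 0) ->
  forall s, Cmod (s - a) < rho -> f s = RtoC 0.
Proof.
  intros Hr Hd H Hz s Hs.
  apply (Cser_unique (fun k => (c k * (s - a) ^ k)%C)); [now apply H|].
  eapply Cser_ext; [|reflexivity|exact Cser_zero].
  intros n. cbv beta. rewrite (expands_zero f a c rho d Hr Hd H Hz). ring.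
Qed.

(** Connectedness of the segment, by a supremum. An expansion at [a] is requested only when [f]
    already vanishes on [(a, be)], because for [zeta] the exclusion of a pole at [a] relies on that
    knowledge. *)
Lemma identity_propagation (f : C -> C) (al be d : R) :
  0 < d -> (forall t : R, be - d < t < be -> f t = RtoC 0) ->
  (forall a : R, al < a < be ->
     (forall t : R, a < t < be -> f t = RtoC 0) ->
     exists c rho, 0 < rho /\ expands f a c rho) ->
  forall a : R, al < a < be ->
    exists rho, 0 < rho /\ forall s, Cmod (s - a) < rho -> f s = RtoC 0.
Proof.
  intros Hd Hstart Hexp.
  assert (Hstep : forall a, al < a < be -> (forall t : R, a < t < be -> f t = RtoC 0) ->
    exists rho, 0 < rho /\ forall s, Cmod (s - a) < rho -> f s = RtoC 0).
  { intros a Ha Hz. destruct (Hexp a Ha Hz) as (c & rho & Hr & Hc).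
    exists rho. split; [exact Hr|].
    apply (expands_zero_near f a c rho (be - a)); [exact Hr|lra|exact Hc|].
    intros t Ht. apply Hz. lra. }
  intros a Ha. apply Hstep; [exact Ha|].
  set (E := fun x => 0 <= x <= be - al /\ forall t : R, be - x < t < be -> f t = RtoC 0).
  assert (HE0 : E (Rmin d (be - al))).
  { split.
    - split; [apply Rmin_glb; lra|apply Rmin_r].
    - intros t Ht. apply Hstart. generalize (Rmin_l d (be - al)). lra. }
  destruct (completeness E) as [L [HL1 HL2]].
  { exists (be - al). intros x [Hx _]. lra. }
  { exists (Rmin d (be - al)). exact HE0. }
  assert (HL0 : 0 < L).
  { eapply Rlt_le_trans; [|apply HL1, HE0]. apply Rmin_glb_lt; lra. }
  assert (HLz : forall t : R, be - L < t < be -> f t = RtoC 0).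
  { intros t Ht. destruct (Ceq_dec (f t) (RtoC 0)) as [Hf|Hf]; [exact Hf|exfalso].
    apply (Rlt_irrefl L). apply Rle_lt_trans with (be - t); [|lra].
    apply HL2. intros x [Hx Hx'].
    apply Rnot_lt_le. intros Hlt. apply Hf, Hx'. lra. }
  destruct (Rlt_le_dec L (be - al)) as [HL|HL].
  (* If the vanishing stopped at [be - L], the neighbourhood of that point would push it further
     left by [e], against the choice of [L]. *)
  - destruct (Hstep (be - L)) as (rho & Hr & Hz); [lra|exact HLz|].
    exfalso. set (e := Rmin (rho / 2) (be - al - L)).
    assert (He : 0 < e) by (apply Rmin_glb_lt; lra).
    assert (He1 : e <= rho / 2) by apply Rmin_l.
    assert (He2 : e <= be - al - L) by apply Rmin_r.
    assert (HE : E (L + e)).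
    { split; [lra|]. intros t Ht.
      destruct (Rlt_le_dec (be - L) t) as [H|H]; [apply HLz; lra|].
      apply Hz. rewrite <- RtoC_minus, Cmod_R.
      apply Rabs_def1; lra. }
    generalize (HL1 _ HE). lra.
  - intros t Ht. apply HLz. lra.
Qed.

(** * Powers of the logarithm and the trapezoidal rule *)

Lemma exp_series (x : R) : is_series (fun k => x ^ k / INR (fact k)) (exp x).
Proof.
  eapply is_series_ext; [|apply (is_exp_Reals x)].
  intros k. rewrite pow_n_pow. reflexivity.
Qed.

Lemma term_le_series (a : nat -> R) (l : R) (j : nat) :
  (forall k, 0 <= a k) -> is_series a l -> a j <= l.
Proof.
  intros Hp H.
  assert (Hs : forall n, 0 <= sum_n a n).
  { intros n. induction n as [|n IH]; [rewrite sum_O; apply Hp|].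
    rewrite sum_Sn. apply Rplus_le_le_0_compat; [exact IH|apply Hp]. }
  apply Rle_trans with (sum_n a j).
  - destruct j as [|j]; [rewrite sum_O; apply Rle_refl|].
    rewrite sum_Sn. generalize (Hs j). unfold plus; simpl. lra.
  - apply (is_lim_seq_incr_compare _ _ H).
    intros n. rewrite sum_Sn. generalize (Hp (S n)). unfold plus; simpl. lra.
Qed.

Lemma pow_div_fact_le_exp (x : R) (j : nat) : 0 <= x -> x ^ j / INR (fact j) <= exp x.
Proof.
  intros Hx. apply (term_le_series (fun k => x ^ k / INR (fact k))); [|apply exp_series].
  intros k. apply Rdiv_le_0_compat; [now apply pow_le|apply INR_fact_lt_0].
Qed.

Lemma is_derive_eq (f : R -> R) (x l l' : R) : l = l' -> is_derive f x l -> is_derive f x l'.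
Proof. now intros ->. Qed.

(* [(- ln t)^k / k!] shifted by two places, so that differentiation is the same
   index shift for every [k]. *)
Definition lpow (k : nat) (t : R) : R :=
  match k with
  | S (S j) => (- ln t) ^ j / INR (fact j)
  | _ => 0
  end.

Lemma is_derive_lpow (k : nat) (t : R) :
  0 < t -> is_derive (lpow (S k)) t (- lpow k t / t).
Proof.
  intros Ht. destruct k as [|[|j]].
  - apply is_derive_eq with 0; [simpl; field; lra|].
    apply (is_derive_const (V := R_NormedModule) 0).
  - apply is_derive_eq with 0; [simpl; field; lra|].
    apply is_derive_ext with (fun _ => 1); [intros; simpl; field|].
    apply (is_derive_const (V := R_NormedModule) 1).
  - change (is_derive (fun t => (- ln t) ^ S j / INR (fact (S j))) t
             (- ((- ln t) ^ j / INR (fact j)) / t)).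
    auto_derive; [exact Ht|].
    change (match j with 0%nat => 1 | S _ => INR j + 1 end) with (INR (S j)).
    change (fact j + j * fact j)%nat with (S j * fact j)%nat. rewrite mult_INR. field.
    repeat split; try lra; [apply INR_fact_neq_0|apply not_0_INR; lia].
Qed.

(** Write [|ln t|^j = (2/3)^j (3/2 |ln t|)^j] and bound one term of the exponential series by its
    sum; [9/4 = (3/2)^2] undoes the index shift by two. The ratio 2/3 is the inverse of the desired
    radius. *)
Lemma lpow_le (k : nat) (t : R) :
  Rabs (lpow k t) <= 9 / 4 * (2 / 3) ^ k * exp (3 / 2 * Rabs (ln t)).
Proof.
  assert (H0 : 0 <= 9 / 4 * (2 / 3) ^ k * exp (3 / 2 * Rabs (ln t))).
  { apply Rmult_le_pos; [|left; apply exp_pos]. apply Rmult_le_pos; [lra|apply pow_le; lra]. }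
  destruct k as [|[|j]]; simpl lpow; try (rewrite Rabs_R0; exact H0).
  unfold Rdiv at 1. rewrite Rabs_mult, <- RPow_abs, Rabs_Ropp.
  rewrite (Rabs_pos_eq (/ _)) by (left; apply Rinv_0_lt_compat, INR_fact_lt_0).
  assert (H := pow_div_fact_le_exp (3 / 2 * Rabs (ln t)) j).
  assert (Hp : 0 < (2 / 3) ^ j) by (apply pow_lt; lra).
  apply Rle_trans with ((2 / 3) ^ j * ((3 / 2 * Rabs (ln t)) ^ j / INR (fact j))).
  - right. rewrite (Rpow_mult_distr (3 / 2)).
    assert (E : (2 / 3) ^ j * (3 / 2) ^ j = 1).
    { rewrite <- Rpow_mult_distr. replace (2 / 3 * (3 / 2)) with 1 by field. apply pow1. }
    transitivity ((2 / 3) ^ j * (3 / 2) ^ j * (Rabs (ln t) ^ j * / INR (fact j))).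
    + rewrite E. ring.
    + generalize ((2 / 3) ^ j) ((3 / 2) ^ j). intros; unfold Rdiv; ring.
  - replace (9 / 4 * (2 / 3) ^ S (S j)) with ((2 / 3) ^ j) by (simpl; field).
    apply Rmult_le_compat_l; [lra|]. apply H.
    apply Rmult_le_pos; [lra|apply Rabs_pos].
Qed.

Lemma lpow_series (w t : R) :
  is_series (fun k => lpow (S (S k)) t * w ^ k) (Rpower t (- w)).
Proof.
  unfold Rpower. replace (- w * ln t) with (w * (- ln t)) by ring.
  eapply is_series_Rext; [|reflexivity|apply (exp_series (w * - ln t))].
  intros k. cbv beta. rewrite Rpow_mult_distr. simpl lpow. field. apply INR_fact_neq_0.
Qed.

(** [(t^(-w) - 1) / w] is minus an antiderivative of [t^(-1-w)]; the subtracted 1 makes it regular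
    at [w = 0]. *)
Lemma lpow_series_shift (w t : R) :
  w <> 0 ->
  is_series (fun k => lpow (S (S (S k))) t * w ^ k) ((Rpower t (- w) - 1) / w).
Proof.
  intros Hw.
  assert (H : is_series (fun k => lpow (S (S (S k))) t * w ^ S k) (Rpower t (- w) - 1)).
  { eapply is_series_Rext; [| |apply (is_series_Rtail _ _ (lpow_series w t))].
    - reflexivity.
    - simpl. field. }
  apply (is_series_Rscal (/ w)) in H.
  replace ((Rpower t (- w) - 1) / w) with (/ w * (Rpower t (- w) - 1)) by (field; exact Hw).
  eapply is_series_Rext; [|reflexivity|exact H]. intros k. cbv beta. rewrite <- tech_pow_Rmult. now field.
Qed.

(** Let [G h] be the error over [[a, a + h]] and [g] its derivative. Both vanish at 0, and [g] has
    derivative [h f2(a + h) / 2]. Two mean value theorems give [G 1 = e c f2(a + e) / 2] with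
    [0 <= e <= c <= 1], so the bound [M] is ample. *)
Lemma trapezoid_error (F f f1 f2 : R -> R) (a M : R) :
  (forall t, a <= t <= a + 1 -> is_derive F t (f t)) ->
  (forall t, a <= t <= a + 1 -> is_derive f t (f1 t)) ->
  (forall t, a <= t <= a + 1 -> is_derive f1 t (f2 t)) ->
  (forall t, a <= t <= a + 1 -> Rabs (f2 t) <= M) ->
  Rabs (/ 2 * (f a + f (a + 1)) - (F (a + 1) - F a)) <= M.
Proof.
  intros HF Hf Hf1 HM.
  set (G := fun h => / 2 * h * (f a + f (a + h)) - (F (a + h) - F a)).
  set (g := fun h => / 2 * (f a - f (a + h)) + / 2 * h * f1 (a + h)).
  assert (dsh : forall (p q : R -> R) h, is_derive p (a + h) (q (a + h)) ->
            is_derive (fun h => p (a + h)) h (q (a + h))).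
  { intros p q h H. apply is_derive_eq with (scal 1 (q (a + h))); [apply Rmult_1_l|].
    apply (is_derive_comp p (fun h => a + h)); [exact H|].
    auto_derive; [exact I|ring]. }
  assert (HG : forall h, 0 <= h <= 1 -> is_derive G h (g h)).
  { intros h Hh. unfold G, g.
    assert (H1 := dsh F f h (HF (a + h) ltac:(lra))).
    assert (H2 := dsh f f1 h (Hf (a + h) ltac:(lra))).
    apply (is_derive_ext (fun h => minus (mult (/ 2 * h) (plus (f a) (f (a + h)))) (minus (F (a + h)) (F a)))).
    { intros t. reflexivity. }
    eapply is_derive_eq; [|apply (is_derive_minus (V := R_NormedModule));
      [apply (is_derive_mult (fun h => / 2 * h));
        [|apply (is_derive_plus (V := R_NormedModule)); [apply is_derive_const|exact H2]
         |intros; apply Rmult_comm]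
      |apply (is_derive_minus (V := R_NormedModule)); [exact H1|apply is_derive_const]]].
    2:{ instantiate (1 := / 2). auto_derive; [exact I|ring]. }
    unfold minus, plus, mult, opp, zero; simpl. field. }
  assert (Hg : forall h, 0 <= h <= 1 -> is_derive g h (/ 2 * h * f2 (a + h))).
  { intros h Hh. unfold g.
    assert (H2 := dsh f f1 h (Hf (a + h) ltac:(lra))).
    assert (H3 := dsh f1 f2 h (Hf1 (a + h) ltac:(lra))).
    apply (is_derive_ext (fun h => plus (mult (/ 2) (minus (f a) (f (a + h)))) (mult (/ 2 * h) (f1 (a + h))))).
    { intros t. reflexivity. }
    eapply is_derive_eq; [|apply (is_derive_plus (V := R_NormedModule));
      [apply (is_derive_mult (fun _ => / 2));
        [apply is_derive_const
        |apply (is_derive_minus (V := R_NormedModule)); [apply is_derive_const|exact H2]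
        |intros; apply Rmult_comm]
      |apply (is_derive_mult (fun h => / 2 * h)); [|exact H3|intros; apply Rmult_comm]]].
    2:{ instantiate (1 := / 2). auto_derive; [exact I|ring]. }
    unfold minus, plus, mult, opp, zero; simpl. field. }
  assert (dcont : forall (p : R -> R) x l, is_derive p x l -> continuity_pt p x).
  { intros p x l H. apply derivable_continuous_pt. exists l. now apply is_derive_Reals. }
  destruct (MVT_gen G 0 1 g) as (c & Hc & Ec).
  { rewrite Rmin_left, Rmax_right by lra. intros x Hx. apply HG. lra. }
  { rewrite Rmin_left, Rmax_right by lra. intros x Hx. apply (dcont _ _ _ (HG x Hx)). }
  rewrite Rmin_left, Rmax_right in Hc by lra.
  destruct (MVT_gen g 0 c (fun h => / 2 * h * f2 (a + h))) as (e & He & Ee).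
  { rewrite Rmin_left, Rmax_right by lra. intros x Hx. apply Hg. lra. }
  { rewrite Rmin_left, Rmax_right by lra. intros x Hx. apply (dcont _ _ _ (Hg x ltac:(lra))). }
  rewrite Rmin_left, Rmax_right in He by lra.
  assert (EG0 : G 0 = 0) by (unfold G; rewrite Rplus_0_r; ring).
  assert (Eg0 : g 0 = 0) by (unfold g; rewrite Rplus_0_r; ring).
  assert (EG1 : G 1 = / 2 * (f a + f (a + 1)) - (F (a + 1) - F a)) by (unfold G; ring).
  rewrite <- EG1.
  replace (G 1) with (/ 2 * e * c * f2 (a + e)) by (rewrite EG0, Eg0 in *; lra).
  assert (HMe := HM (a + e) ltac:(lra)).
  rewrite Rabs_mult, (Rabs_pos_eq (/ 2 * e * c)) by (apply Rmult_le_pos; lra).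
  rewrite <- (Rmult_1_l M).
  apply Rmult_le_compat; [apply Rmult_le_pos; lra|apply Rabs_pos| |exact HMe].
  apply Rle_trans with (/ 2 * 1 * 1); [|lra].
  apply Rmult_le_compat; lra.
Qed.

Lemma exp_nondecr (x y : R) : x <= y -> exp x <= exp y.
Proof. intros [H | ->]; [left; now apply exp_increasing|apply Rle_refl]. Qed.

Lemma Rpower_lim_0 (u w : R) :
  0 < u -> 0 < w -> is_lim_seq (fun n => Rpower (INR n + u) (- w)) 0.
Proof.
  intros Hu Hw. unfold Rpower.
  apply (is_lim_comp_seq exp (fun n => - w * ln (INR n + u)) m_infty 0).
  - apply is_lim_exp_m.
  - exists 0%nat. discriminate.
  - replace m_infty with (Rbar_mult (- w) p_infty).
    2:{ simpl. destruct (Rle_dec 0 (- w)); [exfalso; lra|reflexivity]. }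
    apply is_lim_seq_scal_l.
    apply (is_lim_comp_seq ln (fun n => INR n + u) p_infty p_infty).
    + apply is_lim_ln_p.
    + exists 0%nat. discriminate.
    + eapply is_lim_seq_plus; [apply is_lim_seq_INR|apply is_lim_seq_const|reflexivity].
Qed.

Lemma is_derive_Rpower (x s : R) :
  0 < x -> is_derive (fun t => Rpower t s) x (s * Rpower x (s - 1)).
Proof. intros Hx. apply is_derive_Reals, derivable_pt_lim_power, Hx. Qed.

(** Comparison with a telescoping series: the mean value theorem bounds the term at [n + 1] by a
    decrement of [t^(1-s) / (s - 1)]. This is why the first term is split off. *)
Lemma ex_series_Rpower (m s : R) :
  0 < m -> 1 < s -> ex_series (fun n => Rpower (INR n + m) (- s)).
Proof.
  intros Hm Hs. apply (ex_series_incr_1 (fun n => Rpower (INR n + m) (- s))).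
  set (g := fun n => Rpower (INR n + m) (- (s - 1))).
  apply (ex_series_le (V := R_CompleteNormedModule)) with (fun n => / (s - 1) * (g n - g (S n))).
  - intros n. assert (Hn := pos_INR n). unfold g. rewrite S_INR.
    change (Rabs (Rpower (INR n + 1 + m) (- s)) <=
      / (s - 1) * (Rpower (INR n + m) (- (s - 1)) - Rpower (INR n + 1 + m) (- (s - 1)))).
    rewrite Rabs_pos_eq by (left; apply exp_pos).
    destruct (MVT_gen (fun t => Rpower t (- (s - 1))) (INR n + m) (INR n + 1 + m)
      (fun t => - (s - 1) * Rpower t (- (s - 1) - 1))) as (c & Hc & Ec).
    { rewrite Rmin_left, Rmax_right by lra. intros x Hx. apply is_derive_Rpower. lra. }
    { rewrite Rmin_left, Rmax_right by lra. intros x Hx.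
      apply derivable_continuous_pt. exists (- (s - 1) * Rpower x (- (s - 1) - 1)).
      apply derivable_pt_lim_power. lra. }
    rewrite Rmin_left, Rmax_right in Hc by lra.
    replace (Rpower (INR n + m) (- (s - 1)) - Rpower (INR n + 1 + m) (- (s - 1)))
      with ((s - 1) * Rpower c (- s)).
    2:{ replace (- (s - 1) - 1) with (- s) in Ec by ring. lra. }
    replace (/ (s - 1) * ((s - 1) * Rpower c (- s))) with (Rpower c (- s)) by (field; lra).
    rewrite !Rpower_Ropp. apply Rinv_le_contravar; [apply exp_pos|].
    apply Rle_Rpower_l; lra.
  - exists (/ (s - 1) * (g 0%nat - 0)). apply is_series_Rscal.
    refine (is_lim_seq_ext (fun n => g 0%nat - g (S n)) _ (Finite (g 0%nat - 0)) _ _).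
    + intros n. induction n as [|n IH]; [now rewrite sum_O|].
      rewrite sum_Sn, <- IH. unfold plus; simpl. ring.
    + apply is_lim_seq_minus'; [apply is_lim_seq_const|].
      apply (is_lim_seq_incr_1 g), Rpower_lim_0; lra.
Qed.

(* The k-th Taylor coefficients at [w = 0] of the terms of the Euler-Maclaurin
   (trapezoidal) expansion of [zeta(1 + w, u) - 1 / w]. *)
Definition stieltjes_term (u : R) (N k : nat) : R :=
  match N with
  | O => / 2 * (lpow (S (S k)) u / u) + lpow (S (S (S k))) u
  | S n => let a := INR n + u in
      / 2 * (lpow (S (S k)) a / a + lpow (S (S k)) (a + 1) / (a + 1))
      - (- lpow (S (S (S k))) (a + 1) - - lpow (S (S (S k))) a)
  end.

(** The second derivative of [t^(-1-w)] has order [t^(-3 - Re w)], hence at most [t^(-3/2)] at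
    infinity when [|w| <= 3/2]. Index 0 is the boundary term, which is no trapezoidal error. *)
Definition stieltjes_weight (m : R) (N : nat) : R :=
  match N with
  | O => 1
  | S n => Rpower (INR n + m) (- (3 / 2))
  end.

Lemma ex_series_weight (m : R) : 0 < m -> ex_series (stieltjes_weight m).
Proof.
  intros Hm. apply (ex_series_incr_1 (stieltjes_weight m)).
  apply (ex_series_Rpower m (3 / 2)); lra.
Qed.

Lemma stieltjes_weight_pos (m : R) (N : nat) : 0 < stieltjes_weight m N.
Proof. destruct N; simpl; [lra|apply exp_pos]. Qed.


Lemma is_derive_div_pow (f : R -> R) (t l : R) (n : nat) :
  0 < t -> is_derive f t l ->
  is_derive (fun t => f t / t ^ S n) t (l / t ^ S n - INR (S n) * f t / t ^ S (S n)).
Proof.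
  intros Ht H.
  assert (Hn : t ^ S n <> 0) by (apply pow_nonzero; lra).
  eapply is_derive_eq; [|apply (is_derive_div f (fun t => t ^ S n) t l); [exact H| |exact Hn]].
  2:{ apply is_derive_Reals, derivable_pt_lim_pow. }
  assert (Hn' : t ^ n <> 0) by (apply pow_nonzero; lra).
  simpl Init.Nat.pred. simpl pow. field. split; lra.
Qed.

(** The fraction is the second derivative of [lpow (S (S k)) t / t], and 27/2 is [2 + 3 + 1] times
    the 9/4 of [lpow_le]. For [t >= 1] the quotient [exp(3/2 |ln t|) / t^3] equals [t^(-3/2)]; for
    [t < 1] there is an extra factor [t^(-3)], at most [m^(-3)]. *)
Lemma stieltjes_second_derivative_le (k : nat) (m n t : R) :
  0 < m <= 1 -> 0 <= n -> n + m <= t ->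
  Rabs ((2 * lpow (S (S k)) t + 3 * lpow (S k) t + lpow k t) / t ^ 3) <=
  27 / 2 * exp (- (3 * ln m)) * (Rpower (n + m) (- (3 / 2)) * (2 / 3) ^ k).
Proof.
  intros Hm Hn Ht. assert (Ht0 : 0 < t) by lra.
  set (e := exp (3 / 2 * Rabs (ln t))).
  assert (He : 0 < e) by apply exp_pos.
  assert (Hp : 0 < (2 / 3) ^ k) by (apply pow_lt; lra).
  assert (H0 := lpow_le k t). assert (H1 := lpow_le (S k) t). assert (H2 := lpow_le (S (S k)) t).
  fold e in H0, H1, H2. simpl pow in H1, H2.
  assert (Hpe : 0 < (2 / 3) ^ k * e) by now apply Rmult_lt_0_compat.
  assert (HQ : Rabs (2 * lpow (S (S k)) t + 3 * lpow (S k) t + lpow k t) <=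
    27 / 2 * ((2 / 3) ^ k * e)).
  { eapply Rle_trans; [apply Rabs_triang|].
    eapply Rle_trans; [apply Rplus_le_compat_r, Rabs_triang|].
    rewrite !Rabs_mult, (Rabs_pos_eq 2), (Rabs_pos_eq 3) by lra. nra. }
  assert (Ht3 : 0 < t ^ 3) by (apply pow_lt; lra).
  unfold Rdiv at 1. rewrite Rabs_mult, (Rabs_pos_eq (/ t ^ 3)) by (left; now apply Rinv_0_lt_compat).
  assert (Hlm : ln m <= 0).
  { rewrite <- ln_1. apply ln_le; lra. }
  assert (Hlt : ln m <= ln t) by (apply ln_le; lra).
  assert (HA : e * / t ^ 3 <= exp (- (3 * ln m)) * Rpower (n + m) (- (3 / 2))).
  { assert (Et : t ^ 3 = exp (3 * ln t)).
    { rewrite <- Rpower_pow by lra. unfold Rpower. simpl INR. f_equal. f_equal. ring. }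
    rewrite Et, <- exp_Ropp. unfold e. rewrite <- exp_plus.
    apply Rle_trans with (exp (- (3 * ln m)) * Rpower t (- (3 / 2))).
    - unfold Rpower. rewrite <- exp_plus.
      apply exp_nondecr. unfold Rabs. destruct (Rcase_abs (ln t)); lra.
    - apply Rmult_le_compat_l; [left; apply exp_pos|].
      rewrite !Rpower_Ropp. apply Rinv_le_contravar; [apply exp_pos|].
      apply Rle_Rpower_l; lra. }
  apply Rle_trans with (27 / 2 * ((2 / 3) ^ k * e) * / t ^ 3).
  - apply Rmult_le_compat_r; [left; now apply Rinv_0_lt_compat|exact HQ].
  - replace (27 / 2 * ((2 / 3) ^ k * e) * / t ^ 3)
      with (27 / 2 * (2 / 3) ^ k * (e * / t ^ 3)) by ring.
    replace (27 / 2 * exp (- (3 * ln m)) * (Rpower (n + m) (- (3 / 2)) * (2 / 3) ^ k))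
      with (27 / 2 * (2 / 3) ^ k * (exp (- (3 * ln m)) * Rpower (n + m) (- (3 / 2)))) by ring.
    apply Rmult_le_compat_l; [lra|exact HA].
Qed.

(** [K] is uniform in [u] for the sake of the later integration, and does not depend on [N] or [k],
    so the majorant has the product form required by [series_fubini]. *)
Lemma stieltjes_term_le (m M : R) :
  0 < m <= 1 -> m <= M ->
  exists K, 0 <= K /\ forall u N k, m <= u <= M ->
    Rabs (stieltjes_term u N k) <= K * (stieltjes_weight m N * (2 / 3) ^ k).
Proof.
  intros Hm HM.
  set (L := Rabs (ln m) + Rabs (ln M)).
  set (K0 := 9 / 4 * exp (3 / 2 * L) * (/ m + 1)).
  set (K1 := 27 / 2 * exp (- (3 * ln m))).
  assert (Him : 0 < / m) by (apply Rinv_0_lt_compat; lra).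
  assert (HK0 : 0 < K0).
  { unfold K0. repeat apply Rmult_lt_0_compat; try apply exp_pos; lra. }
  assert (HK1 : 0 < K1) by (apply Rmult_lt_0_compat; [lra|apply exp_pos]).
  exists (K0 + K1). split; [lra|]. intros u N k Hu.
  assert (Hp : 0 < (2 / 3) ^ k) by (apply pow_lt; lra).
  assert (Hw : 0 < stieltjes_weight m N * (2 / 3) ^ k).
  { apply Rmult_lt_0_compat; [apply stieltjes_weight_pos|exact Hp]. }
  rewrite Rmult_plus_distr_r.
  destruct N as [|n].
  - apply Rle_trans with (K0 * (stieltjes_weight m 0 * (2 / 3) ^ k)); [|nra].
    simpl stieltjes_weight. cbn [stieltjes_term]. rewrite Rmult_1_l.
    set (e := exp (3 / 2 * L)). assert (He : 0 < e) by apply exp_pos.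
    assert (Hlnu : Rabs (ln u) <= L).
    { assert (ln m <= ln u) by (apply ln_le; lra).
      assert (ln u <= ln M) by (apply ln_le; lra).
      unfold L, Rabs. repeat destruct Rcase_abs; lra. }
    assert (Hb : forall j, Rabs (lpow j u) <= 9 / 4 * (2 / 3) ^ j * e).
    { intros j. eapply Rle_trans; [apply lpow_le|].
      apply Rmult_le_compat_l.
      - apply Rmult_le_pos; [lra|apply pow_le; lra].
      - apply exp_nondecr. lra. }
    assert (H2 := Hb (S (S k))). assert (H3 := Hb (S (S (S k)))).
    set (q := 9 / 4 * (2 / 3) ^ k * e).
    assert (Hq : 0 < q) by (unfold q; repeat apply Rmult_lt_0_compat; lra).
    assert (H2' : Rabs (lpow (S (S k)) u) <= q).
    { eapply Rle_trans; [exact H2|]. unfold q. simpl pow. nra. }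
    assert (H3' : Rabs (lpow (S (S (S k))) u) <= q).
    { eapply Rle_trans; [exact H3|]. unfold q. simpl pow. nra. }
    replace (K0 * (2 / 3) ^ k) with (q * / m + q) by (unfold K0, q, e; ring).
    eapply Rle_trans; [apply Rabs_triang|]. apply Rplus_le_compat; [|exact H3'].
    unfold Rdiv. rewrite !Rabs_mult, (Rabs_pos_eq (/ 2)) by lra.
    assert (Hiu : 0 < / u) by (apply Rinv_0_lt_compat; lra).
    rewrite (Rabs_pos_eq (/ u)) by lra.
    assert (/ u <= / m) by (apply Rinv_le_contravar; lra).
    apply Rle_trans with (1 * (q * / m)); [|lra].
    apply Rmult_le_compat; [lra| |lra|].
    + apply Rmult_le_pos; [apply Rabs_pos|lra].
    + apply Rmult_le_compat; [apply Rabs_pos|lra|exact H2'|lra].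
  - apply Rle_trans with (K1 * (stieltjes_weight m (S n) * (2 / 3) ^ k)); [|nra].
    simpl stieltjes_weight. unfold stieltjes_term. cbv zeta.
    assert (Hn := pos_INR n).
    apply (trapezoid_error (fun t => - lpow (S (S (S k))) t) (fun t => lpow (S (S k)) t / t)
      (fun t => (- lpow (S (S k)) t - lpow (S k) t) / t ^ 2)
      (fun t => (2 * lpow (S (S k)) t + 3 * lpow (S k) t + lpow k t) / t ^ 3)).
    + intros t Ht. apply is_derive_eq with (- (- lpow (S (S k)) t / t)); [field; lra|].
      apply (is_derive_opp (V := R_NormedModule)). apply is_derive_lpow. lra.
    + intros t Ht. apply (is_derive_ext (fun t => lpow (S (S k)) t / t ^ 1)).
      { intros x. now rewrite pow_1. }
      eapply is_derive_eq; [|eapply (is_derive_div_pow _ t _ 0); [lra|apply is_derive_lpow; lra]].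
      cbn [pow INR]. field. lra.
    + intros t Ht.
      eapply is_derive_eq; [|eapply (is_derive_div_pow _ t _ 1); [lra|
        apply (is_derive_minus (V := R_NormedModule));
        [apply (is_derive_opp (V := R_NormedModule))|]; apply is_derive_lpow; lra]].
      unfold minus, plus, opp; cbn -[lpow pow INR]. cbn [pow INR]. field. lra.
    + intros t Ht. unfold K1. apply stieltjes_second_derivative_le; lra.
Qed.

(** * Expansion of the Hurwitz zeta function at 1 *)

Lemma is_series_Rplus (a b : nat -> R) (l l' : R) :
  is_series a l -> is_series b l' -> is_series (fun n => a n + b n) (l + l').
Proof. exact (is_series_plus a b l l'). Qed.

Lemma is_series_Rminus (a b : nat -> R) (l l' : R) :
  is_series a l -> is_series b l' -> is_series (fun n => a n - b n) (l - l').
Proof. exact (is_series_minus a b l l'). Qed.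

(* The terms of the Euler-Maclaurin expansion of [zeta(1 + w, u) - 1 / w]. *)
Definition trapezoid_term (w u : R) (N : nat) : R :=
  match N with
  | O => / 2 * (Rpower u (- w) / u) + (Rpower u (- w) - 1) / w
  | S n => let a := INR n + u in
      / 2 * (Rpower a (- w) / a + Rpower (a + 1) (- w) / (a + 1))
      + ((Rpower (a + 1) (- w) - 1) / w - (Rpower a (- w) - 1) / w)
  end.

Lemma stieltjes_term_series (w u : R) (N : nat) :
  w <> 0 -> is_series (fun k => stieltjes_term u N k * w ^ k) (trapezoid_term w u N).
Proof.
  intros Hw.
  destruct N as [|n].
  - eapply is_series_Rext; [| |exact (is_series_Rplus _ _ _ _
        (is_series_Rscal (/ 2 * / u) _ _ (lpow_series w u)) (lpow_series_shift w u Hw))].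
    + intros k. cbv beta. unfold stieltjes_term. unfold Rdiv. ring.
    + unfold trapezoid_term. unfold Rdiv. ring.
  - set (a := INR n + u).
    eapply is_series_Rext; [| |exact (is_series_Rplus _ _ _ _
        (is_series_Rplus _ _ _ _
          (is_series_Rscal (/ 2 * / a) _ _ (lpow_series w a))
          (is_series_Rscal (/ 2 * / (a + 1)) _ _ (lpow_series w (a + 1))))
        (is_series_Rminus _ _ _ _ (lpow_series_shift w (a + 1) Hw) (lpow_series_shift w a Hw)))].
    + intros k. cbv beta. unfold stieltjes_term. fold a. cbv zeta. unfold Rdiv. ring.
    + unfold trapezoid_term. fold a. cbv zeta. unfold Rdiv. ring.
Qed.

(** The partial sums telescope to the partial sum for [Z], minus half its last term, plus
    [(t^(-w) - 1) / w] at the last node [t]. In the limit this last summand leaves the polar part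
    [- 1 / w]. *)
Lemma trapezoid_term_series (w u Z : R) :
  0 < w -> 0 < u ->
  is_series (fun n => Rpower (INR n + u) (- (1 + w))) Z ->
  is_series (trapezoid_term w u) (Z - 1 / w).
Proof.
  intros Hw Hu HZ.
  set (H := fun n => Rpower (INR n + u) (- w) / (INR n + u)).
  assert (EH : forall n, Rpower (INR n + u) (- (1 + w)) = H n).
  { intros n. assert (Hn := pos_INR n). unfold H.
    replace (- (1 + w)) with (- w + - 1) by ring. rewrite Rpower_plus.
    rewrite (Rpower_Ropp _ 1), Rpower_1 by lra. reflexivity. }
  apply (is_series_Rext _ H Z Z EH eq_refl) in HZ.
  refine (is_lim_seq_ext (fun n => sum_n H n - / 2 * H n + (Rpower (INR n + u) (- w) - 1) / w)
    _ (Finite (Z - 1 / w)) _ _).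
  - intros n. induction n as [|n IH].
    + rewrite !sum_O. unfold H. simpl INR. rewrite Rplus_0_l. simpl. lra.
    + rewrite !sum_Sn, <- IH. unfold plus; simpl AbelianMonoid.plus.
      unfold H at 2 3. unfold trapezoid_term. cbv zeta.
      rewrite S_INR. replace (INR n + 1 + u) with (INR n + u + 1) by ring.
      unfold H. cbn. lra.
  - replace (Z - 1 / w) with (Z - / 2 * 0 + (0 - 1) / w) by (field; lra).
    apply is_lim_seq_plus'.
    + apply is_lim_seq_minus'; [exact HZ|].
      apply (is_lim_seq_scal_l H (/ 2) 0). apply ex_series_lim_0. now exists Z.
    + apply (is_lim_seq_scal_r _ (/ w) (0 - 1)).
      apply is_lim_seq_minus'; [now apply Rpower_lim_0|apply is_lim_seq_const].
Qed.

(* The k-th Taylor coefficient of [zeta(1 + w, u) - 1 / w] at [w = 0]. *)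
Definition stieltjes_coef (k : nat) (u : R) : R := Series (fun N => stieltjes_term u N k).

Lemma interval_enlarge (a b : R) :
  0 < a -> exists m M, 0 < m <= 1 /\ m <= M /\ m <= a /\ b <= M.
Proof.
  intros Ha. exists (Rmin a 1), (Rmax b 1).
  assert (0 < Rmin a 1) by (apply Rmin_glb_lt; lra).
  generalize (Rmin_l a 1) (Rmin_r a 1) (Rmax_l b 1) (Rmax_r b 1). lra.
Qed.

(* [K] and the tails [e n] are uniform in [u] and decay geometrically in [k]. *)
Lemma stieltjes_coef_bounds (a b : R) :
  0 < a ->
  exists K e, is_lim_seq e 0 /\ forall k u, a <= u <= b ->
    is_series (fun N => stieltjes_term u N k) (stieltjes_coef k u) /\
    Rabs (stieltjes_coef k u) <= K * (2 / 3) ^ k /\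
    forall n, Rabs (stieltjes_coef k u - sum_n (fun N => stieltjes_term u N k) n)
      <= e n * (2 / 3) ^ k.
Proof.
  intros Ha. destruct (interval_enlarge a b Ha) as (m & M & Hm & HmM & Hma & HbM).
  destruct (stieltjes_term_le m M Hm HmM) as (K & HK & HT).
  destruct (ex_series_weight m) as [W HW]; [lra|].
  exists (K * W), (fun n => K * (W - sum_n (stieltjes_weight m) n)). split.
  { replace (Finite 0) with (Finite (K * (W - W))) by (f_equal; ring).
    apply (is_lim_seq_scal_l _ K (W - W)), is_lim_seq_minus'; [apply is_lim_seq_const|exact HW]. }
  intros k u Hu.
  assert (Hle : forall N, Rabs (stieltjes_term u N k) <= K * (2 / 3) ^ k * stieltjes_weight m N).
  { intros N. eapply Rle_trans; [apply HT; lra|]. right; ring. }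
  assert (HS : is_series (fun N => stieltjes_term u N k) (stieltjes_coef k u)).
  { apply Series_correct.
    apply (ex_series_le (V := R_CompleteNormedModule)) with
      (fun N => K * (2 / 3) ^ k * stieltjes_weight m N); [exact Hle|].
    exists (K * (2 / 3) ^ k * W). now apply is_series_Rscal. }
  split; [exact HS|split].
  - replace (K * W * (2 / 3) ^ k) with (K * (2 / 3) ^ k * W) by ring.
    exact (is_series_norm_le (V := R_NormedModule) _ _ _ _ Hle HS
             (is_series_Rscal (K * (2 / 3) ^ k) _ _ HW)).
  - intros n.
    replace (K * (W - sum_n (stieltjes_weight m) n) * (2 / 3) ^ k)
      with (K * (2 / 3) ^ k * (W - sum_n (stieltjes_weight m) n)) by ring.
    exact (is_series_norm_le (V := R_NormedModule) _ _ _ _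
             (fun N => Hle (S n + N)%nat)
             (is_series_tail (V := R_NormedModule) _ _ n HS)
             (is_series_Rscal (K * (2 / 3) ^ k) _ _
               (is_series_tail (V := R_NormedModule) _ _ n HW))).
Qed.

Lemma ex_series_geom_scal (K w : R) :
  0 <= w < 3 / 2 -> ex_series (fun k => K * (2 / 3 * w) ^ k).
Proof.
  intros Hw. exists (K * / (1 - 2 / 3 * w)). apply is_series_Rscal, is_series_geom.
  rewrite Rabs_pos_eq; lra.
Qed.

(** Nodes [N] and Taylor index [k] are exchanged; the majorant in [k] is geometric of ratio [2/3 w],
    which is where [w < 3/2] enters. *)
Lemma stieltjes_coef_series (w u Z : R) :
  0 < w < 3 / 2 -> 0 < u ->
  is_series (fun n => Rpower (INR n + u) (- (1 + w))) Z ->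
  is_series (fun k => stieltjes_coef k u * w ^ k) (Z - 1 / w).
Proof.
  intros Hw Hu HZ.
  destruct (interval_enlarge u u Hu) as (m & M & Hm & HmM & Hma & HbM).
  destruct (stieltjes_term_le m M Hm HmM) as (K & HK & HT).
  destruct (stieltjes_coef_bounds u u Hu) as (K' & e & _ & HB).
  destruct (series_fubini (V := R_CompleteNormedModule)
    (fun N k => stieltjes_term u N k * w ^ k)
    (stieltjes_weight m) (fun k => K * (2 / 3 * w) ^ k)
    (trapezoid_term w u) (fun k => stieltjes_coef k u * w ^ k)) as (S & H1 & H2).
  - intros N k.
    change (Rabs (stieltjes_term u N k * w ^ k) <= stieltjes_weight m N * (K * (2 / 3 * w) ^ k)).
    assert (Hwk : 0 <= w ^ k) by (apply pow_le; lra).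
    rewrite Rabs_mult, (Rabs_pos_eq (w ^ k)), Rpow_mult_distr by exact Hwk.
    replace (stieltjes_weight m N * (K * ((2 / 3) ^ k * w ^ k)))
      with (K * (stieltjes_weight m N * (2 / 3) ^ k) * w ^ k) by ring.
    apply Rmult_le_compat_r; [exact Hwk|]. apply HT. lra.
  - apply ex_series_weight. lra.
  - apply ex_series_geom_scal. lra.
  - intros N. apply stieltjes_term_series. lra.
  - intros k. destruct (HB k u) as [HS _]; [lra|].
    eapply is_series_Rext; [| |exact (is_series_Rscal (w ^ k) _ _ HS)].
    + intros n. apply Rmult_comm.
    + apply Rmult_comm.
  - replace (Z - 1 / w) with (S : R); [exact H2|].
    assert (H3 := trapezoid_term_series w u Z (proj1 Hw) Hu HZ).
    exact (filterlim_locally_unique (V := R_NormedModule) _ _ _ H1 H3).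
Qed.

(** * Integration in the parameter *)

Lemma RInt_uniform_limit (f : nat -> R -> R) (g : R -> R) (a b : R) (e I : nat -> R) :
  is_lim_seq e 0 ->
  (forall n u, Rmin a b <= u <= Rmax a b -> Rabs (g u - f n u) <= e n) ->
  (forall n, is_RInt (f n) a b (I n)) ->
  exists J, is_lim_seq I (Finite J) /\ is_RInt g a b J.
Proof.
  intros He Hfg HI.
  (* [filterlim_RInt] takes uniform convergence on the whole line, so the functions are replaced by
     0 off the interval. Using [Rmin] and [Rmax] covers [b < a], which occurs when [x < 1]. *)
  set (clip := fun (h : R -> R) u => if Rle_dec (Rmin a b) u then
                 if Rle_dec u (Rmax a b) then h u else 0 else 0).
  assert (Hclip : forall h u, Rmin a b < u < Rmax a b -> clip h u = h u).
  { intros h u Hu. unfold clip.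
    destruct Rle_dec; [|exfalso; lra]. destruct Rle_dec; [reflexivity|exfalso; lra]. }
  destruct (filterlim_RInt (V := R_CompleteNormedModule) (fun n => clip (f n)) a b eventually _ (clip g) I)
    as (J & HJ & HgJ).
  - intros n. apply (is_RInt_ext (V := R_NormedModule) (f n)); [|apply HI].
    intros u Hu. now rewrite Hclip.
  - apply filterlim_locally. intros eps.
    apply is_lim_seq_spec in He. destruct (He eps) as [N HN].
    exists N. intros n Hn u. specialize (HN n Hn). rewrite Rminus_0_r in HN.
    change (Rabs (clip (f n) u - clip g u) < eps).
    unfold clip. destruct Rle_dec as [H1|H1]; [destruct Rle_dec as [H2|H2]|].
    + rewrite Rabs_minus_sym. eapply Rle_lt_trans; [now apply Hfg|].
      eapply Rle_lt_trans; [apply Rle_abs|exact HN].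
    + rewrite Rminus_0_r, Rabs_R0. apply cond_pos.
    + rewrite Rminus_0_r, Rabs_R0. apply cond_pos.
  - exists J. split; [exact HJ|].
    apply (is_RInt_ext (V := R_NormedModule) (clip g)); [|exact HgJ].
    intros u Hu. now apply Hclip.
Qed.

Lemma is_RInt_sum_n (f : nat -> R -> R) (I : nat -> R) (a b : R) (n : nat) :
  (forall k, is_RInt (f k) a b (I k)) ->
  is_RInt (fun u => sum_n (fun k => f k u) n) a b (sum_n I n).
Proof.
  intros H. induction n as [|n IH].
  - rewrite sum_O. apply (is_RInt_ext (V := R_NormedModule) (f 0%nat)); [|apply H].
    intros u _. now rewrite sum_O.
  - rewrite sum_Sn.
    apply (is_RInt_ext (V := R_NormedModule)
      (fun u => plus (sum_n (fun k => f k u) n) (f (S n) u))).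
    + intros u _. now rewrite sum_Sn.
    + apply (is_RInt_plus (V := R_NormedModule)); [exact IH|apply H].
Qed.

Lemma ex_derive_lpow (k : nat) (t : R) : 0 < t -> ex_derive (lpow k) t.
Proof.
  intros Ht. destruct k as [|k].
  - exists 0. apply (is_derive_const (V := R_NormedModule) 0).
  - eexists. now apply is_derive_lpow.
Qed.

Lemma continuous_stieltjes_term (N k : nat) (u : R) :
  0 < u -> continuous (fun u => stieltjes_term u N k) u.
Proof.
  intros Hu. apply (ex_derive_continuous (V := R_NormedModule)).
  unfold stieltjes_term.
  generalize (ex_derive_lpow (S (S k))) (ex_derive_lpow (S (S (S k)))).
  generalize (lpow (S (S k))) (lpow (S (S (S k)))). intros f g Hf Hg.
  destruct N as [|n]; cbv zeta.
  - auto_derive. repeat split; try apply Hf; try apply Hg; lra.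
  - assert (Hn := pos_INR n).
    auto_derive. repeat split; try apply Hf; try apply Hg; lra.
Qed.

Lemma is_RInt_stieltjes_coef (a b : R) :
  0 < a -> 0 < b -> exists J, forall k, is_RInt (stieltjes_coef k) a b (J k).
Proof.
  intros Ha Hb. exists (fun k => RInt (stieltjes_coef k) a b). intros k.
  apply (RInt_correct (V := R_CompleteNormedModule)).
  assert (Hm : 0 < Rmin a b) by (now apply Rmin_glb_lt).
  destruct (stieltjes_coef_bounds (Rmin a b) (Rmax a b) Hm) as (K & e & He & HB).
  destruct (RInt_uniform_limit
    (fun n u => sum_n (fun N => stieltjes_term u N k) n) (stieltjes_coef k) a b
    (fun n => e n * (2 / 3) ^ k)
    (sum_n (fun N => RInt (fun u => stieltjes_term u N k) a b))) as (J & _ & HJ).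
  - replace (Finite 0) with (Rbar_mult 0 ((2 / 3) ^ k)) by (simpl; f_equal; ring).
    now apply is_lim_seq_scal_r.
  - intros n u Hu. apply HB. exact Hu.
  - intros n. apply (is_RInt_sum_n (fun N u => stieltjes_term u N k)). intros N.
    apply (RInt_correct (V := R_CompleteNormedModule)).
    apply (ex_RInt_continuous (V := R_CompleteNormedModule)).
    intros u Hu. apply continuous_stieltjes_term. lra.
  - now exists J.
Qed.

(** [(N + u)^(-w)] has [u]-derivative [- w (N + u)^(-1-w)]. Termwise integration thus leads from
    [1 + w] to [w], and [w > 1] keeps the series at the endpoints convergent. *)
Lemma is_RInt_hurwitz (Z : R -> R -> R) (w a b : R) :
  (forall s u, 1 < s -> 0 < u -> is_series (fun n => Rpower (INR n + u) (- s)) (Z s u)) ->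
  0 < a -> 0 < b -> 1 < w ->
  is_RInt (Z (1 + w)) a b ((Z w a - Z w b) / w).
Proof.
  intros HZ Ha Hb Hw.
  assert (Hm : 0 < Rmin a b) by (now apply Rmin_glb_lt).
  set (m := Rmin a b) in *.
  destruct (RInt_uniform_limit
    (fun n u => sum_n (fun N => Rpower (INR N + u) (- (1 + w))) n) (Z (1 + w)) a b
    (* The terms decrease in [u], so the tail at the left end [m] dominates the others. *)
    (fun n => Z (1 + w) m - sum_n (fun N => Rpower (INR N + m) (- (1 + w))) n)
    (sum_n (fun N => / w * (Rpower (INR N + a) (- w) - Rpower (INR N + b) (- w)))))
    as (J & HJ & HJ').
  - replace (Finite 0) with (Finite (Z (1 + w) m - Z (1 + w) m)) by (f_equal; ring).
    apply is_lim_seq_minus'; [apply is_lim_seq_const|]. apply HZ; lra.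
  - intros n u Hu. fold m in Hu.
    refine (is_series_norm_le (V := R_NormedModule) _ _ _ _ _
             (is_series_tail (V := R_NormedModule) _ _ n (HZ (1 + w) u ltac:(lra) ltac:(lra)))
             (is_series_tail (V := R_NormedModule) _ _ n (HZ (1 + w) m ltac:(lra) ltac:(lra)))).
    intros k. change (Rabs (Rpower (INR (S n + k) + u) (- (1 + w))) <=
                      Rpower (INR (S n + k) + m) (- (1 + w))).
    rewrite Rabs_pos_eq by (left; apply exp_pos).
    assert (Hk := pos_INR (S n + k)).
    rewrite !Rpower_Ropp. apply Rinv_le_contravar; [apply exp_pos|].
    apply Rle_Rpower_l; lra.
  - intros n. apply (is_RInt_sum_n (fun N u => Rpower (INR N + u) (- (1 + w)))
      (fun N => / w * (Rpower (INR N + a) (- w) - Rpower (INR N + b) (- w)))). intros N.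
    assert (HN := pos_INR N).
    replace (/ w * (Rpower (INR N + a) (- w) - Rpower (INR N + b) (- w)))
      with (minus (- / w * Rpower (INR N + b) (- w)) (- / w * Rpower (INR N + a) (- w)))
      by (unfold minus, plus, opp; simpl; ring).
    assert (Hd : forall p u, m <= u -> is_derive (fun u => Rpower (INR N + u) p) u
      (p * Rpower (INR N + u) (p - 1))).
    { intros p u Hu. apply is_derive_eq with (scal 1 (p * Rpower (INR N + u) (p - 1)));
        [apply Rmult_1_l|].
      apply (is_derive_comp (fun t => Rpower t p) (fun u => INR N + u)).
      - apply is_derive_Rpower. lra.
      - auto_derive; [exact I|ring]. }
    apply (is_RInt_derive (V := R_CompleteNormedModule)
      (fun u => - / w * Rpower (INR N + u) (- w))).
    + intros u Hu. fold m in Hu.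
      apply is_derive_eq with (- / w * (- w * Rpower (INR N + u) (- w - 1))).
      * replace (- (1 + w)) with (- w - 1) by ring. field. lra.
      * apply (is_derive_scal (fun u => Rpower (INR N + u) (- w))). apply Hd. lra.
    + intros u Hu. fold m in Hu. apply (ex_derive_continuous (V := R_NormedModule)).
      eexists. apply Hd. lra.
  - replace ((Z w a - Z w b) / w) with J; [exact HJ'|].
    assert (HL : is_series (fun N => / w * (Rpower (INR N + a) (- w) - Rpower (INR N + b) (- w)))
                   (/ w * (Z w a - Z w b))).
    { apply is_series_Rscal, is_series_Rminus; apply HZ; lra. }
    assert (E := filterlim_locally_unique (V := R_NormedModule) _ _ _ HJ HL).
    rewrite E. unfold Rdiv. apply Rmult_comm.
Qed.

(** The two evaluations of the same integral meet here: [w > 1] is needed for the sums [Z w], and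
    [w < 3/2] for the Taylor series of [Z (1 + w) u - 1 / w]. *)
Lemma stieltjes_integral_series (Z : R -> R -> R) (J : nat -> R) (w a b : R) :
  (forall s u, 1 < s -> 0 < u -> is_series (fun n => Rpower (INR n + u) (- s)) (Z s u)) ->
  0 < a -> 0 < b -> 1 < w < 3 / 2 ->
  (forall k, is_RInt (stieltjes_coef k) a b (J k)) ->
  is_series (fun k => J k * w ^ k) ((Z w a - Z w b - (b - a)) / w).
Proof.
  intros HZ Ha Hb Hw HJ.
  assert (Hm : 0 < Rmin a b) by (now apply Rmin_glb_lt).
  destruct (stieltjes_coef_bounds (Rmin a b) (Rmax a b) Hm) as (K & e & _ & HB).
  destruct (ex_series_geom_scal K w) as [T HT]; [lra|].
  destruct (RInt_uniform_limit
    (fun n u => sum_n (fun k => stieltjes_coef k u * w ^ k) n)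
    (fun u => Z (1 + w) u - 1 / w) a b
    (fun n => T - sum_n (fun k => K * (2 / 3 * w) ^ k) n)
    (sum_n (fun k => J k * w ^ k))) as (J' & HJ1 & HJ2).
  - replace (Finite 0) with (Finite (T - T)) by (f_equal; ring).
    apply is_lim_seq_minus'; [apply is_lim_seq_const|exact HT].
  - intros n u Hu.
    assert (Hs := stieltjes_coef_series w u (Z (1 + w) u) ltac:(lra) ltac:(lra)
                    (HZ (1 + w) u ltac:(lra) ltac:(lra))).
    refine (is_series_norm_le (V := R_NormedModule) _ _ _ _ _
             (is_series_tail (V := R_NormedModule) _ _ n Hs)
             (is_series_tail (V := R_NormedModule) _ _ n HT)).
    intros k. change (Rabs (stieltjes_coef (S n + k) u * w ^ (S n + k)) <=
                      K * (2 / 3 * w) ^ (S n + k)).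
    assert (Hwk : 0 <= w ^ (S n + k)) by (apply pow_le; lra).
    rewrite Rabs_mult, (Rabs_pos_eq (w ^ _)), Rpow_mult_distr, <- Rmult_assoc by exact Hwk.
    apply Rmult_le_compat_r; [exact Hwk|]. now apply HB.
  - intros n. apply (is_RInt_sum_n (fun k u => stieltjes_coef k u * w ^ k) (fun k => J k * w ^ k)).
    intros k. apply (is_RInt_ext (V := R_NormedModule) (fun u => scal (w ^ k) (stieltjes_coef k u))).
    { intros u _. apply Rmult_comm. }
    replace (J k * w ^ k) with (scal (w ^ k) (J k)) by apply Rmult_comm.
    apply (is_RInt_scal (V := R_NormedModule)). apply HJ.
  - replace ((Z w a - Z w b - (b - a)) / w) with J'; [exact HJ1|].
    assert (H2 : is_RInt (fun u => minus (Z (1 + w) u) (1 / w)) a b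
                   (minus ((Z w a - Z w b) / w) (scal (b - a) (1 / w)))).
    { apply (is_RInt_minus (V := R_NormedModule)).
      - apply is_RInt_hurwitz; [exact HZ|exact Ha|exact Hb|lra].
      - apply (is_RInt_const (V := R_NormedModule)). }
    apply (is_RInt_unique (V := R_CompleteNormedModule)) in HJ2.
    apply (is_RInt_unique (V := R_CompleteNormedModule)) in H2.
    rewrite <- HJ2. etransitivity; [exact H2|].
    unfold minus, plus, opp, scal; simpl; unfold mult; simpl. field. lra.
Qed.

(** * Continuation to 0 *)

Lemma expands_minus (f g : C -> C) (a : C) (c d : nat -> C) (rho : R) :
  expands f a c rho -> expands g a d rho ->
  expands (fun s => (f s - g s)%C) a (fun k => (c k - d k)%C) rho.
Proof.
  intros Hf Hg s Hs.
  eapply Cser_ext; [|reflexivity|exact (Cser_minus _ _ _ _ (Hf s Hs) (Hg s Hs))].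
  intros n. cbv beta. ring.
Qed.

Lemma expands_const (l a : C) (rho : R) :
  expands (fun _ => l) a (fun k => match k with O => l | S _ => RtoC 0 end) rho.
Proof.
  intros s _.
  eapply Cser_ext; [intros n; reflexivity| |
    apply (Cser_cons (fun k => (match k with O => l | S _ => RtoC 0 end * (s - a) ^ k)%C) (RtoC 0))].
  - simpl. ring.
  - eapply Cser_ext; [|reflexivity|exact Cser_zero]. intros n. cbv beta. ring.
Qed.

Lemma expands_mul_sub (f : C -> C) (a b : C) (c : nat -> C) (rho : R) :
  expands f a c rho ->
  expands (fun s => ((s - b) * f s)%C) a
    (fun k => match k with
              | O => ((a - b) * c O)%C
              | S j => ((a - b) * c (S j) + c j)%C
              end) rho.
Proof.
  intros H s Hs. specialize (H s Hs).
  assert (H1 := Cser_plus _ _ _ _ (Cser_tail _ _ (Cser_scal (a - b)%C _ _ H))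
                  (Cser_scal (s - a)%C _ _ H)).
  eapply Cser_ext; [intros n; reflexivity| |
    apply (Cser_cons (fun k => (match k with
              | O => ((a - b) * c O)%C
              | S j => ((a - b) * c (S j) + c j)%C
              end * (s - a) ^ k)%C))].
  2:{ eapply Cser_ext; [|reflexivity|exact H1]. intros n. cbv beta. rewrite Cpow_S. ring. }
  cbv beta. change ((s - a) ^ 0)%C with (RtoC 1). ring.
Qed.

Lemma expands_of_locally (f : C -> C) (a : C) (c : nat -> C) :
  locally a (fun s => C_is_pseries c (s - a)%C (f s)) ->
  exists rho, 0 < rho /\ expands f a c rho.
Proof.
  intros H. destruct (Cmod_of_locally a _ H) as (r & Hr & Hs).
  exists r. split; [exact Hr|]. intros s Hsr. exact (proj1 (C_is_pseries_iff c (s - a)%C (f s)) (Hs s Hsr)).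
Qed.

Lemma sum_n_RtoC (r : nat -> R) (n : nat) :
  sum_n (fun k => RtoC (r k)) n = RtoC (sum_n r n).
Proof.
  induction n as [|n IH]; [now rewrite !sum_O|].
  rewrite !sum_Sn, IH. symmetry. apply RtoC_plus.
Qed.

Lemma Cser_RtoC (r : nat -> R) (l : R) :
  is_series r l -> Cser (fun k => RtoC (r k)) (RtoC l).
Proof.
  intros H. unfold is_series.
  apply filterlim_ext with (fun n => RtoC (sum_n r n)).
  { intros n. symmetry. apply sum_n_RtoC. }
  apply (filterlim_locally (U := C_UniformSpace)). intros eps.
  apply (proj1 (filterlim_locally (U := R_UniformSpace) _ _)) with (eps := eps) in H.
  destruct H as [N HN]. exists N. intros n Hn. split; [apply HN, Hn|apply ball_center].
Qed.

Lemma Cser_RtoC_inv (r : nat -> R) (l : C) :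
  Cser (fun k => RtoC (r k)) l -> is_series r (Re l) /\ l = RtoC (Re l).
Proof.
  intros H.
  assert (Hb : forall eps : posreal, eventually (fun n => ball l eps (RtoC (sum_n r n)))).
  { intros eps.
    destruct (proj1 (filterlim_locally (U := C_UniformSpace) _ _) H eps) as [N HN].
    exists N. intros n Hn. rewrite <- sum_n_RtoC. apply HN, Hn. }
  assert (H1 : is_series r (Re l)).
  { apply (filterlim_locally (U := R_UniformSpace)). intros eps.
    destruct (Hb eps) as [N HN]. exists N. intros n Hn. apply (HN n Hn). }
  split; [exact H1|].
  exact (Cser_unique _ _ _ H (Cser_RtoC r (Re l) H1)).
Qed.

Lemma Rpow_C_real (a s : R) : Rpow_C a (- RtoC s)%C = RtoC (Rpower a (- s)).
Proof.
  unfold Rpow_C, Cexp, Rpower.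
  replace (- RtoC s * RtoC (ln a))%C with (RtoC (- s * ln a))
    by (rewrite RtoC_mult, RtoC_opp; reflexivity).
  rewrite re_RtoC, im_RtoC, cos_0, sin_0.
  unfold RtoC. f_equal; ring.
Qed.

Lemma hurwitz_real (zeta : C -> R -> C) (s u : R) :
  is_hurwitz_zeta zeta -> 1 < s -> 0 < u ->
  is_series (fun n => Rpower (INR n + u) (- s)) (Re (zeta (RtoC s) u)) /\
  zeta (RtoC s) u = RtoC (Re (zeta (RtoC s) u)).
Proof.
  intros Hz Hs Hu. apply Cser_RtoC_inv.
  destruct (Hz u Hu) as [_ H]. specialize (H (RtoC s) Hs).
  eapply Cser_ext; [|reflexivity|exact H].
  intros n. cbv beta. apply Rpow_C_real.
Qed.

(** The future regular part of [zeta] at 1, defined without reference to [zeta], on a disc of radius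
    3/2 that contains 0. *)
Definition stieltjes_sum (u : R) (s : C) : C :=
  Csum (fun k => (RtoC (stieltjes_coef k u) * (s - RtoC 1) ^ k)%C).

Lemma stieltjes_sum_expands (u : R) :
  0 < u -> expands (stieltjes_sum u) (RtoC 1) (fun k => RtoC (stieltjes_coef k u)) (3 / 2).
Proof.
  intros Hu. destruct (stieltjes_coef_bounds u u Hu) as (K & e & _ & HB).
  apply expands_of_bound with K; [lra|].
  intros k. destruct (HB k u) as (_ & H & _); [lra|].
  rewrite Cmod_R.
  apply Rle_trans with (K * (2 / 3) ^ k * (3 / 2) ^ k).
  - apply Rmult_le_compat_r; [apply pow_le; lra|exact H].
  - rewrite Rmult_assoc, <- Rpow_mult_distr.
    replace (2 / 3 * (3 / 2)) with 1 by field. rewrite pow1. lra.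
Qed.

Lemma hurwitz_eq_right_of_1 (zeta : C -> R -> C) (t u : R) :
  is_hurwitz_zeta zeta -> 0 < u -> 0 < t < 3 / 2 ->
  stieltjes_sum u (RtoC (1 + t)) = (zeta (RtoC (1 + t)) u - 1 / RtoC t)%C.
Proof.
  intros Hz Hu Ht.
  destruct (hurwitz_real zeta (1 + t) u Hz) as [H1 H2]; [lra|exact Hu|].
  apply (stieltjes_coef_series t u _ Ht Hu) in H1.
  assert (E : (RtoC (1 + t) - RtoC 1)%C = RtoC t) by (rewrite RtoC_plus; ring).
  apply (Cser_unique (fun k => (RtoC (stieltjes_coef k u) * (RtoC (1 + t) - RtoC 1) ^ k)%C)).
  - apply (stieltjes_sum_expands u Hu). rewrite E, Cmod_R, Rabs_pos_eq; lra.
  - eapply Cser_ext; [| |exact (Cser_RtoC _ _ H1)].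
    + intros n. cbv beta. rewrite E, RtoC_mult, RtoC_pow. reflexivity.
    + rewrite H2 at 2. rewrite RtoC_minus, RtoC_div by lra. reflexivity.
Qed.

Section Continuation.
Context (zeta : C -> R -> C) (gamma : nat -> R -> C).
Context (Hz : is_hurwitz_zeta zeta) (Hg : is_stieltjes zeta gamma).

(** Real points just right of 1 identify the coefficients. Equality then holds in a full punctured
    disc, whose points left of 1 are the start of the continuation. *)
Lemma stieltjes_eq (u : R) (Hu : 0 < u) :
  (forall p, ((-1) ^ p / INR (fact p) * gamma p u)%C = RtoC (stieltjes_coef p u)) /\
  exists r, 0 < r /\ forall s : C, Cmod (s - RtoC 1) < r -> s <> RtoC 1 ->
    (zeta s u - 1 / (s - RtoC 1))%C = stieltjes_sum u s.
Proof.
  set (g := fun p => ((-1) ^ p / INR (fact p) * gamma p u)%C).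
  destruct (Cmod_of_locally _ _ (Hg u Hu)) as (r & Hr & Hs).
  assert (Hg' : forall s : C, Cmod (s - RtoC 1) < r -> s <> RtoC 1 ->
    Cser (fun k => (g k * (s - RtoC 1) ^ k)%C) (zeta s u - 1 / (s - RtoC 1))%C).
  { intros s Hsr Hs1.
    exact (proj1 (C_is_pseries_iff g (s - RtoC 1)%C (zeta s u - 1 / (s - RtoC 1))%C) (Hs s Hsr Hs1)). }
  assert (Eg : forall p, g p = RtoC (stieltjes_coef p u)).
  { intros p. apply Ceq_minus.
    apply (pseries_zero p (fun p => (g p - RtoC (stieltjes_coef p u))%C) (Rmin r (3 / 2))).
    { apply Rmin_glb_lt; lra. }
    intros t Ht.
    assert (Ht1 : t < r) by (eapply Rlt_le_trans; [apply Ht|apply Rmin_l]).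
    assert (Ht2 : t < 3 / 2) by (eapply Rlt_le_trans; [apply Ht|apply Rmin_r]).
    assert (E : (RtoC (1 + t) - RtoC 1)%C = RtoC t) by (rewrite RtoC_plus; ring).
    assert (Ht0 : RtoC t <> RtoC 0) by (apply RtoC_nz; lra).
    assert (H1 := Hg' (RtoC (1 + t))). assert (H2 := stieltjes_sum_expands u Hu (RtoC (1 + t))).
    rewrite hurwitz_eq_right_of_1 with (zeta := zeta) in H2; [|exact Hz|exact Hu|lra].
    rewrite E, Cmod_R, Rabs_pos_eq in H1, H2 by lra.
    eapply Cser_ext; [| |apply (Cser_minus _ _ _ _ (H1 Ht1 ltac:(intros E1; apply Ht0; rewrite <- E, E1; ring)) (H2 Ht2))].
    - intros n. cbv beta. ring.
    - cbv beta. ring. }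
  split; [exact Eg|].
  exists (Rmin r (3 / 2)). split; [apply Rmin_glb_lt; lra|]. intros s Hsr Hs1.
  apply (Cser_unique (fun k => (g k * (s - RtoC 1) ^ k)%C)).
  - apply Hg'; [|exact Hs1]. eapply Rlt_le_trans; [exact Hsr|apply Rmin_l].
  - eapply Cser_ext; [|reflexivity|apply (stieltjes_sum_expands u Hu)].
    + intros n. cbv beta. now rewrite Eg.
    + eapply Rlt_le_trans; [exact Hsr|apply Rmin_r].
Qed.

(* For [s <> 1], vanishes exactly where [zeta s u = 1 / (s - 1) + stieltjes_sum u s]. *)
Definition laurent_defect (u : R) (s : C) : C :=
  ((s - RtoC 1) * (zeta s u - stieltjes_sum u s) - RtoC 1)%C.

Lemma laurent_defect_zero (u : R) (s : C) :
  s <> RtoC 1 -> laurent_defect u s = RtoC 0 ->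
  zeta s u = (stieltjes_sum u s + / (s - RtoC 1))%C.
Proof.
  intros Hs H.
  assert (Hs' : (s - RtoC 1)%C <> RtoC 0) by (now apply Cminus_eq_contra).
  apply Ceq_minus.
  replace (zeta s u - (stieltjes_sum u s + / (s - RtoC 1)))%C
    with (laurent_defect u s / (s - RtoC 1))%C
    by (unfold laurent_defect; field; exact Hs').
  rewrite H. field. exact Hs'.
Qed.

(** At a pole [(s - a)^m zeta(s, u)] would tend to [c_0 <> 0]. But just right of [a] the function
    equals [stieltjes_sum u s + 1 / (s - 1)], which is bounded, so [|c_0|] is at most a constant
    times [t]. The bound [a > -1/2] keeps [a] inside the disc of radius 3/2 about 1. *)
Lemma not_pole_left_of_1 (u a : R) :
  0 < u -> - (1 / 2) < a < 1 ->
  (forall t : R, a < t < 1 -> laurent_defect u t = RtoC 0) ->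
  ~ pole_at (fun s => zeta s u) (RtoC a).
Proof.
  intros Hu Ha Hz0 (m & c & Hm & Hc0 & Hloc). apply Hc0.
  destruct (Cmod_of_locally _ _ Hloc) as (r & Hr & Hs). clear Hloc.
  assert (Ha1 : Cmod (RtoC a - RtoC 1) < 3 / 2).
  { rewrite <- RtoC_minus, Cmod_R. apply Rabs_def1; lra. }
  destruct (expands_recenter _ _ _ _ _ (stieltjes_sum_expands u Hu) Ha1) as (d & _ & Hd).
  destruct (expands_first_order _ _ _ _ (proj1 (Rminus_lt_0 _ _) Ha1) Hd) as (K & r1 & Hr1 & HK).
  assert (E : forall t : R, (RtoC (a + t) - RtoC a)%C = RtoC t)
    by (intros t; rewrite RtoC_plus; ring).
  assert (Hser : forall t, 0 < t < r -> Cser (fun k => (c k * RtoC t ^ k)%C)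
                                  (RtoC t ^ m * zeta (RtoC (a + t)) u)%C).
  { intros t Ht. apply (proj1 (C_is_pseries_iff c (RtoC t) (RtoC t ^ m * zeta (RtoC (a + t)) u)%C)).
    assert (H := Hs (RtoC (a + t))). cbv beta in H. rewrite E in H. apply H.
    - rewrite Cmod_R, Rabs_pos_eq; lra.
    - intros E'. apply RtoC_inj in E'. lra. }
  destruct (pseries_bound_of_conv c (r / 2) _ ltac:(lra) (Hser (r / 2) ltac:(lra))) as [M HM].
  (* [B] bounds [zeta] at [a + t]: the variation of [stieltjes_sum] from [a], its value at [a], and
     the polar part for [t < (1 - a) / 2]. *)
  set (B := Rabs K * r1 + Cmod (stieltjes_sum u (RtoC a)) + 2 / (1 - a)).
  apply Cmod_eq_0, Rle_antisym; [|apply Cmod_ge_0].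
  (* The four bounds on [t] serve, in order, the half disc of [pseries_first_order], the estimate
     [HK], the inequality [t^m <= t], and the distance to the pole at 1. *)
  apply Rle_0_of_small with (B + 2 * (M / (r / 2)))
    (Rmin (Rmin (r / 4) r1) (Rmin 1 ((1 - a) / 2))).
  { repeat apply Rmin_glb_lt; lra. }
  intros t [Ht0 Ht].
  apply Rmin_Rgt_l in Ht. destruct Ht as [Ht Ht'].
  apply Rmin_Rgt_l in Ht. destruct Ht as [Ht1 Ht2].
  apply Rmin_Rgt_l in Ht'. destruct Ht' as [Ht3 Ht4].
  assert (H1 : Cmod (RtoC t ^ m * zeta (RtoC (a + t)) u - c 0%nat) <= 2 * (M / (r / 2)) * t).
  { apply Rle_trans with (2 * (M / (r / 2)) * Cmod (RtoC t)).
    - apply pseries_first_order; [lra|exact HM| |apply Hser; lra].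
      rewrite Cmod_R, Rabs_pos_eq; lra.
    - rewrite Cmod_R, Rabs_pos_eq; lra. }
  assert (H2 : Cmod (zeta (RtoC (a + t)) u) <= B).
  { rewrite (laurent_defect_zero u (RtoC (a + t))).
    2:{ intros E'. apply RtoC_inj in E'. lra. }
    2:{ apply Hz0. lra. }
    replace (stieltjes_sum u (RtoC (a + t)))
      with ((stieltjes_sum u (RtoC (a + t)) - stieltjes_sum u (RtoC a)) + stieltjes_sum u (RtoC a))%C by ring.
    eapply Rle_trans; [apply Cmod_triangle|]. unfold B. apply Rplus_le_compat.
    - eapply Rle_trans; [apply Cmod_triangle|]. apply Rplus_le_compat_r.
      eapply Rle_trans; [apply HK; rewrite E, Cmod_R, Rabs_pos_eq; lra|].
      rewrite E, Cmod_R, (Rabs_pos_eq t) by lra.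
      apply Rle_trans with (Rabs K * t).
      + apply Rmult_le_compat_r; [lra|apply Rle_abs].
      + apply Rmult_le_compat_l; [apply Rabs_pos|lra].
    - rewrite <- RtoC_minus, Cmod_inv.
      2:{ apply RtoC_nz. lra. }
      rewrite Cmod_R, Rabs_left by lra.
      replace (2 / (1 - a)) with (/ ((1 - a) / 2)) by (field; lra).
      apply Rinv_le_contravar; lra. }
  replace (c 0%nat) with (RtoC t ^ m * zeta (RtoC (a + t)) u
                           - (RtoC t ^ m * zeta (RtoC (a + t)) u - c 0%nat))%C by ring.
  eapply Rle_trans; [apply Cmod_triangle|]. rewrite Cmod_opp, Rmult_plus_distr_r.
  apply Rplus_le_compat; [|exact H1].
  rewrite Cmod_mult, Cmod_pow, Cmod_R, (Rabs_pos_eq t) by lra.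
  rewrite (Rmult_comm B). apply Rmult_le_compat; [apply pow_le; lra|apply Cmod_ge_0| |exact H2].
  destruct m as [|m]; [lia|]. simpl.
  assert (t ^ m <= 1) by (rewrite <- (pow1 m); apply pow_incr; lra).
  apply Rle_trans with (t * 1); [apply Rmult_le_compat_l|]; lra.
Qed.

Lemma hurwitz_expands_left_of_1 (u a : R) :
  0 < u -> - (1 / 2) < a < 1 ->
  (forall t : R, a < t < 1 -> laurent_defect u t = RtoC 0) ->
  exists c rho, 0 < rho /\ expands (fun s => zeta s u) (RtoC a) c rho.
Proof.
  intros Hu Ha Hz0. destruct (proj1 (Hz u Hu) (RtoC a)) as [[c Hc]|Hp].
  - destruct (expands_of_locally _ _ _ Hc) as (rho & Hrho). now exists c, rho.
  - exfalso. exact (not_pole_left_of_1 u a Hu Ha Hz0 Hp).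
Qed.

Lemma laurent_defect_zero_near (u a : R) :
  0 < u -> - (1 / 2) < a < 1 ->
  exists rho, 0 < rho /\ forall s, Cmod (s - RtoC a) < rho -> laurent_defect u s = RtoC 0.
Proof.
  intros Hu. destruct (stieltjes_eq u Hu) as (_ & r & Hr & Heq). revert a.
  apply (identity_propagation (laurent_defect u) (- (1 / 2)) 1 r Hr).
  - intros t Ht. unfold laurent_defect.
    assert (Ht1 : RtoC t <> RtoC 1) by (intros E; apply RtoC_inj in E; lra).
    rewrite <- Heq; [|rewrite <- RtoC_minus, Cmod_R, Rabs_left; lra|exact Ht1].
    field. now apply Cminus_eq_contra.
  - intros a Ha Hz0.
    destruct (hurwitz_expands_left_of_1 u a Hu Ha Hz0) as (c & rho & Hrho & Hc).
    assert (Ha1 : Cmod (RtoC a - RtoC 1) < 3 / 2).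
    { rewrite <- RtoC_minus, Cmod_R. apply Rabs_def1; lra. }
    destruct (expands_recenter _ _ _ _ _ (stieltjes_sum_expands u Hu) Ha1) as (d & _ & Hd).
    set (rho' := Rmin rho (3 / 2 - Cmod (RtoC a - RtoC 1))).
    exists (fun k => (match k with
       | O => (RtoC a - RtoC 1) * (c O - d O)
       | S j => (RtoC a - RtoC 1) * (c (S j) - d (S j)) + (c j - d j)
       end - match k with O => RtoC 1 | S _ => RtoC 0 end)%C), rho'.
    split; [apply Rmin_glb_lt; lra|].
    apply (expands_minus (fun s => ((s - RtoC 1) * (zeta s u - stieltjes_sum u s))%C)
             (fun _ => RtoC 1)); [|apply expands_const].
    apply (expands_mul_sub (fun s => (zeta s u - stieltjes_sum u s)%C) _ _ (fun k => (c k - d k)%C)).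
    apply (expands_minus (fun s => zeta s u)).
    + apply expands_le with rho; [apply Rmin_l|exact Hc].
    + eapply expands_le; [apply Rmin_r|exact Hd].
Qed.

Lemma hurwitz_expands_0 (u : R) :
  0 < u -> exists c rho, 0 < rho <= 1 /\ expands (fun s => zeta s u) (RtoC 0) c rho /\
    forall s, Cmod (s - RtoC 0) < rho -> zeta s u = (stieltjes_sum u s + / (s - RtoC 1))%C.
Proof.
  intros Hu.
  destruct (hurwitz_expands_left_of_1 u 0 Hu) as (c & rho & Hrho & Hc); [lra| |].
  { intros t Ht. destruct (laurent_defect_zero_near u t Hu) as (r & Hr & H); [lra|].
    apply H. rewrite Cminus_diag, Cmod_0. exact Hr. }
  destruct (laurent_defect_zero_near u 0 Hu) as (r & Hr & H); [lra|].
  (* The 1 in the minimum keeps [s = 1], where [zeta] is unconstrained, out of the disc. *)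
  exists c, (Rmin 1 (Rmin rho r)). split; [|split].
  - split; [repeat apply Rmin_glb_lt; lra|apply Rmin_l].
  - apply expands_le with rho; [|exact Hc].
    eapply Rle_trans; [apply Rmin_r|apply Rmin_l].
  - intros s Hs. apply laurent_defect_zero.
    + intros E. subst s.
      assert (H1 : Cmod (RtoC 1 - RtoC 0) < 1) by (eapply Rlt_le_trans; [exact Hs|apply Rmin_l]).
      rewrite <- RtoC_minus, Cmod_R, Rabs_pos_eq in H1; lra.
    + apply H. eapply Rlt_le_trans; [exact Hs|].
      eapply Rle_trans; [apply Rmin_r|apply Rmin_r].
Qed.

(** Near 0, [zeta(s, x) - zeta(s, 1) = - (x - 1) - s j(s)], where [j] has the Taylor coefficients
    [J k]; the coefficients of [s^(p+1)] are compared. *)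
Lemma stieltjes_integral_taylor (x : R) (J : nat -> R) (p : nat) :
  0 < x -> (forall k, is_RInt (stieltjes_coef k) 1 x (J k)) ->
  (C_derive_n (fun s => zeta s x) (S p) (RtoC 0)
   - C_derive_n (fun s => zeta s 1%R) (S p) (RtoC 0))%C
  = RtoC (- (INR (fact (S p)) * J p)).
Proof.
  intros Hx HJ.
  destruct (hurwitz_expands_0 x Hx) as (cx & rx & Hrx & Hcx & Ex).
  destruct (hurwitz_expands_0 1 Rlt_0_1) as (c1 & r1 & Hr1 & Hc1 & E1).
  set (Z := fun s u => Re (zeta (RtoC s) u)).
  assert (HZ : forall s u, 1 < s -> 0 < u ->
            is_series (fun n => Rpower (INR n + u) (- s)) (Z s u)).
  { intros s u Hs Hu. apply (hurwitz_real zeta s u Hz Hs Hu). }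
  assert (HJs : forall w, 1 < w < 3 / 2 ->
    Cser (fun k => (RtoC (J k) * RtoC w ^ k)%C) (RtoC ((Z w 1 - Z w x - (x - 1)) / w))).
  { intros w Hw.
    eapply Cser_ext; [| |exact (Cser_RtoC _ _ (stieltjes_integral_series Z J w 1 x HZ Rlt_0_1 Hx Hw HJ))].
    - intros n. cbv beta. now rewrite RtoC_mult, RtoC_pow.
    - reflexivity. }
  (* Convergence at a point between 1 and 3/2 makes [j] analytic on a disc about 0 that reaches the
     region where [zeta] is a sum. *)
  destruct (pseries_bound_of_conv _ (5 / 4) _ ltac:(lra) (HJs (5 / 4) ltac:(lra))) as [M HM].
  assert (Hj := expands_of_bound _ (RtoC 0) (5 / 4) M ltac:(lra) HM).
  set (j := fun s => Csum (fun k => (RtoC (J k) * (s - RtoC 0) ^ k)%C)) in Hj.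
  assert (HH := expands_minus _ _ _ _ _ _ (expands_const (RtoC (- (x - 1))) (RtoC 0) (5 / 4))
                  (expands_mul_sub _ _ (RtoC 0) _ _ Hj)).
  assert (HD := expands_minus _ _ _ _ _ _ (stieltjes_sum_expands x Hx)
                  (stieltjes_sum_expands 1 Rlt_0_1)).
  cbv beta in HH, HD.
  set (Hf := fun s => (RtoC (- (x - 1)) - (s - RtoC 0) * j s)%C) in HH.
  (* The polar parts [1 / (s - 1)] cancel in the difference, so [D] is analytic at 1 and the
     identity can cross that point, where [zeta] itself is unconstrained. *)
  set (D := fun s => (stieltjes_sum x s - stieltjes_sum 1 s)%C) in HD.
  assert (Hprop : exists rho, 0 < rho /\ forall s, Cmod (s - RtoC 0) < rho -> (D s - Hf s)%C = RtoC 0).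
  (* The identity starts on [(1, 5/4)] and moves left past 0; every point of [(-1/4, 5/4)] is within
     5/4 of both centres 0 and 1. *)
  { apply (identity_propagation (fun s => (D s - Hf s)%C) (- (1 / 4)) (5 / 4) (1 / 4)); [lra| | |lra].
    - intros t Ht.
      assert (ED : D (RtoC t) = RtoC (Z t x - Z t 1)).
      { unfold D. replace t with (1 + (t - 1)) at 1 2 by ring.
        rewrite !(hurwitz_eq_right_of_1 zeta) by (try exact Hz; lra).
        replace (1 + (t - 1)) with t by ring.
        rewrite (proj2 (hurwitz_real zeta t x Hz ltac:(lra) Hx)).
        rewrite (proj2 (hurwitz_real zeta t 1 Hz ltac:(lra) Rlt_0_1)).
        fold (Z t x) (Z t 1). rewrite (RtoC_minus (Z t x)). ring. }
      assert (Ej : j (RtoC t) = RtoC ((Z t 1 - Z t x - (x - 1)) / t)).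
      { apply (Cser_unique (fun k => (RtoC (J k) * RtoC t ^ k)%C)); [|apply HJs; lra].
        assert (E0 : (RtoC t - RtoC 0)%C = RtoC t) by ring.
        assert (H := Hj (RtoC t)). rewrite E0 in H. apply H.
        rewrite Cmod_R, Rabs_pos_eq; lra. }
      rewrite ED. unfold Hf. rewrite Ej, <- RtoC_minus, <- RtoC_mult, <- !RtoC_minus.
      f_equal. field. lra.
    - intros a Ha _.
      assert (Ha1 : Cmod (RtoC a - RtoC 1) < 3 / 2).
      { rewrite <- RtoC_minus, Cmod_R. apply Rabs_def1; lra. }
      assert (Ha0 : Cmod (RtoC a - RtoC 0) < 5 / 4).
      { rewrite <- RtoC_minus, Cmod_R. apply Rabs_def1; lra. }
      destruct (expands_recenter _ _ _ _ _ HD Ha1) as (d & _ & Hd).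
      destruct (expands_recenter _ _ _ _ _ HH Ha0) as (e & _ & He).
      exists (fun k => (d k - e k)%C),
        (Rmin (3 / 2 - Cmod (RtoC a - RtoC 1)) (5 / 4 - Cmod (RtoC a - RtoC 0))).
      split; [apply Rmin_glb_lt; lra|].
      apply expands_minus; (eapply expands_le; [|eassumption]); [apply Rmin_l|apply Rmin_r]. }
  destruct Hprop as (r2 & Hr2 & Hprop).
  set (r := Rmin (Rmin rx r1) (Rmin r2 1)).
  assert (Hr0 : 0 < r) by (unfold r; repeat apply Rmin_glb_lt; lra).
  assert (Hrrx : r <= rx) by (eapply Rle_trans; [apply Rmin_l|apply Rmin_l]).
  assert (Hrr1 : r <= r1) by (eapply Rle_trans; [apply Rmin_l|apply Rmin_r]).
  assert (Hrr2 : r <= r2) by (eapply Rle_trans; [apply Rmin_r|apply Rmin_l]).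
  assert (Hr1' : r <= 1) by (eapply Rle_trans; [apply Rmin_r|apply Rmin_r]).
  assert (Hall := expands_minus _ _ _ _ _ _
    (expands_minus _ _ _ _ _ _ (expands_le _ _ _ r rx Hrrx Hcx) (expands_le _ _ _ r r1 Hrr1 Hc1))
    (expands_le _ _ _ r (5 / 4) ltac:(lra) HH)).
  assert (H0 := expands_zero _ 0 _ r r Hr0 Hr0 Hall).
  rewrite (C_derive_n_center _ _ _ _ (S p) (proj1 Hrx) Hcx).
  rewrite (C_derive_n_center _ _ _ _ (S p) (proj1 Hr1) Hc1).
  (* [Hall] expands [zeta(s, x) - zeta(s, 1) - Hf s], which vanishes near 0; the factor [s] in [Hf]
     places [- J p] at index [S p]. *)
  assert (Hp : (cx (S p) - c1 (S p))%C = RtoC (- J p)).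
  { apply Ceq_minus. rewrite <- (fun h => H0 h (S p)).
    - rewrite RtoC_opp. ring.
    - intros t Ht.
      assert (Hts : Cmod (RtoC t - RtoC 0) < r).
      { rewrite <- RtoC_minus, Cmod_R, Rabs_pos_eq; lra. }
      cbv beta. rewrite Ex, E1 by lra.
      rewrite <- (Hprop (RtoC t)) by lra. unfold D. ring. }
  replace (- (INR (fact (S p)) * J p)) with (INR (fact (S p)) * - J p) by ring.
  rewrite RtoC_mult, <- Hp. ring.
Qed.

End Continuation.

Theorem mainTheorem2
  (zeta : C -> R -> C) (hzeta : is_hurwitz_zeta zeta)
  (gamma : nat -> R -> C) (hgamma : is_stieltjes zeta gamma)
  (p : nat) (x : R) (hx : 0 < x) :
  @is_RInt C_R_NormedModule (fun u : R => gamma p u) 1 x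
    ((-1) ^ (p + 1) / INR (p + 1) *
      (C_derive_n (fun s : C => zeta s x) (p + 1) 0
       - C_derive_n (fun s : C => zeta s 1%R) (p + 1) 0))%C.
Proof.
  destruct (is_RInt_stieltjes_coef 1 x Rlt_0_1 hx) as [J HJ].
  replace (p + 1)%nat with (S p) by lia.
  rewrite (stieltjes_integral_taylor zeta gamma hzeta hgamma x J p hx HJ).
  assert (Hf := INR_fact_neq_0 p).
  assert (Hsgn : (-1) ^ p * (-1) ^ p = 1).
  { rewrite <- Rpow_mult_distr. replace (-1 * -1) with 1 by ring. apply pow1. }
  (* [(-1)^p] is its own inverse, so [q] inverts the factor [(-1)^p / p!] of [is_stieltjes]. *)
  set (q := (-1) ^ p * INR (fact p)).
  assert (Hgam : forall u, 0 < u -> gamma p u = RtoC (q * stieltjes_coef p u)).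
  { intros u Hu. rewrite RtoC_mult, <- (proj1 (stieltjes_eq zeta gamma hzeta hgamma u Hu) p).
    unfold q. rewrite RtoC_mult, RtoC_pow.
    replace ((-1) ^ p * INR (fact p) * ((-1) ^ p / INR (fact p) * gamma p u))%C
      with ((-1) ^ p * (-1) ^ p * gamma p u)%C by (field; now apply RtoC_nz).
    rewrite <- RtoC_pow, <- RtoC_mult, Hsgn. ring. }
  replace ((-1) ^ S p / INR (S p) * RtoC (- (INR (fact (S p)) * J p)))%C
    with (RtoC (q * J p)).
  - apply (is_RInt_ext (V := C_R_NormedModule) (fun u => RtoC (q * stieltjes_coef p u))).
    + intros u Hu. symmetry. apply Hgam.
      assert (0 < Rmin 1 x) by (apply Rmin_glb_lt; lra). lra.
    (* Integration in [C] is componentwise, and the imaginary component is 0. *)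
    + apply (is_RInt_fct_extend_pair (fun u => RtoC (q * stieltjes_coef p u)) 1 x (q * J p) 0).
      * apply (is_RInt_scal (V := R_NormedModule) (stieltjes_coef p) 1 x q (J p)), HJ.
      * assert (H0 := is_RInt_const (V := R_NormedModule) 1 x 0).
        change (scal (x - 1) 0) with ((x - 1) * 0) in H0. rewrite Rmult_0_r in H0. exact H0.
  - assert (HS : INR (S p) <> 0) by (apply not_0_INR; lia).
    rewrite <- RtoC_pow, <- RtoC_div, <- RtoC_mult by exact HS. f_equal.
    unfold q. rewrite fact_simpl, mult_INR. simpl pow. field. exact HS.
Qed.
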